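(* Let $\Omega$ be an alphabet, and let $P$ be a computable finite probability space on $\Omega$. Let $X\colon\Omega\to\mathbb{R}$ be a real random variable on $\Omega$ such that $X(a)$ is a computable real for all $a\in\Omega$ and $V(X)>0$. Let $\alpha\in\Omega^\infty$ be Martin-Löf $P$-random. Then, for every real $t>0$, the following conditions (i) and (ii) are equivalent: (i) There exists $M\in\mathbb{N}^+$ such that for every integer $n\ge M$ and every $k\in\mathbb{N}^+$, if $k\ge n^t$ then $$\left|\frac{1}{k}\sum_{i=1}^k X(\alpha(i))-E(X)\right|<\frac{1}{n}.$$ (ii) $t>2$.
   Context: $\mathbb{N}=\{0,1,2,\dots\}$ and $\mathbb{N}^+$ is the set of positive integers. An alphabet is a non-empty finite set. For an alphabet $\Omega$, $\Omega^*$ is the set of finite strings over $\Omega$ (including the empty string) and $\Omega^\infty$ is the set of infinite sequences $\alpha=\alpha(1)\alpha(2)\cdots$ over $\Omega$; $\alpha(i)$ is the $i$th element and $\alpha\restriction_n$ is the string of the first $n$ elements of $\alpha$. For $S\subset\Omega^*$, $[S]^{\prec}=\{\alpha\in\Omega^\infty\mid \exists n\in\mathbb{N}\ \alpha\restriction_n\in S\}$. A finite probability space on $\Omega$ is a function $P\colon\Omega\to\mathbb{R}$ with $P(a)\ge 0$ for all $a\in\Omega$ and $\sum_{a\in\Omega}P(a)=1$. A real $x$ is computable if there is a total recursive $f\colon\mathbb{N}\to\mathbb{Q}$ with $|x-f(k)|<2^{-k}$ for all $k\in\mathbb{N}$; $P$ is computable if $P(a)$ is a computable real for every $a\in\Omega$.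 The Bernoulli measure $\lambda_P$ is the probability measure on the Borel $\sigma$-field of $\Omega^\infty$ (generated by all sets $[S]^{\prec}$) with $\lambda_P([\{\sigma_1\cdots\sigma_n\}]^{\prec})=P(\sigma_1)\cdots P(\sigma_n)$ for every string $\sigma_1\cdots\sigma_n\in\Omega^*$. A real random variable on $\Omega$ is a function $X\colon\Omega\to\mathbb{R}$; its mean is $E(X)=\sum_{a\in\Omega}X(a)P(a)$ and its variance is $V(X)=\sum_{a\in\Omega}(X(a)-E(X))^2P(a)$. A Martin-Löf $P$-test is an r.e. (recursively enumerable) set $\mathcal{C}\subset\mathbb{N}^+\times\Omega^*$ such that $\lambda_P([\mathcal{C}_n]^{\prec})<2^{-n}$ for every $n\in\mathbb{N}^+$, where $\mathcal{C}_n=\{\sigma\mid(n,\sigma)\in\mathcal{C}\}$. A sequence $\alpha\in\Omega^\infty$ passes $\mathcal{C}$ if $\alpha\notin[\mathcal{C}_n]^{\prec}$ for some $n\in\mathbb{N}^+$. $\alpha$ is Martin-Löf $P$-random if it passes every Martin-Löf $P$-test. *)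

(* Defs.v *)
From HB Require Import structures.
From mathcomp Require Export all_boot all_order all_algebra.
From mathcomp Require Export all_classical all_reals all_analysis.

Set Implicit Arguments.
Unset Strict Implicit.
Unset Printing Implicit Defensive.

Import Order.TTheory GRing.Theory Num.Theory.
Local Open Scope classical_set_scope.

(* Non-empty finite sets: measurable types in MathComp-Analysis are pointed, so
   non-emptiness is recorded by the point. *)
#[short(type="alphabetType")]
HB.structure Definition Alphabet := {T of Finite T & Pointed T}.

(* Partial functions are represented by their graphs. *)
Section recursive_functions.
Local Open Scope nat_scope.

(* graph of f where f(0, x) = g(x) and f(k + 1, x) = h(k, f(k, x), x) *)
Fixpoint primrec_graph n (g : n.-tuple nat -> nat -> Prop)
    (h : n.+2.-tuple nat -> nat -> Prop) (x : n.-tuple nat) (k y : nat)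
    : Prop :=
  if k is k'.+1
  then exists2 z, primrec_graph g h x k' z & h [tuple of k' :: z :: x] y
  else g x y.

(* graph of the partial function sending x to the least y with f(y, x) = 0;
   f(z, x) must be defined for all z < y *)
Definition min_graph n (f : n.+1.-tuple nat -> nat -> Prop) (x : n.-tuple nat)
    (y : nat) : Prop :=
  f [tuple of y :: x] 0 /\
  forall z, z < y -> exists v, f [tuple of z :: x] v.+1.

Inductive partial_recursive : forall n, (n.-tuple nat -> nat -> Prop) -> Prop :=
| PR_zero n : partial_recursive (fun (_ : n.-tuple nat) y => y = 0)
| PR_succ : partial_recursive (fun (x : 1.-tuple nat) y => y = (thead x).+1)
| PR_proj n (i : 'I_n) :
    partial_recursive (fun (x : n.-tuple nat) y => y = tnth x i)
| PR_comp n m (g : m.-tuple nat -> nat -> Prop)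
      (h : 'I_m -> n.-tuple nat -> nat -> Prop) :
    partial_recursive g -> (forall i, partial_recursive (h i)) ->
    partial_recursive (fun (x : n.-tuple nat) y =>
      exists2 z : m.-tuple nat, (forall i, h i x (tnth z i)) & g z y)
| PR_rec n (g : n.-tuple nat -> nat -> Prop)
      (h : n.+2.-tuple nat -> nat -> Prop) :
    partial_recursive g -> partial_recursive h ->
    partial_recursive (fun (x : n.+1.-tuple nat) y =>
      primrec_graph g h [tuple of behead x] (thead x) y)
| PR_min n (f : n.+1.-tuple nat -> nat -> Prop) :
    partial_recursive f -> partial_recursive (min_graph f).

Definition total_recursive (f : nat -> nat) : Prop :=
  partial_recursive (fun (x : 1.-tuple nat) y => y = f (thead x)).

(* [CodeSeq.decode] is the computable bijection from nat to seq nat of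
   MathComp. *)
Definition recursively_enumerable (A : set (seq nat)) : Prop :=
  A = set0 \/
  exists2 f : nat -> nat,
    total_recursive f & A = range (fun k => CodeSeq.decode (f k)).

End recursive_functions.

Local Open Scope ring_scope.

Definition total_recursive_rat (f : nat -> rat) : Prop :=
  exists a b c : nat -> nat,
    [/\ total_recursive a, total_recursive b, total_recursive c
      & forall k, f k = ((a k)%:R - (b k)%:R) / (c k).+1%:R].

Definition computable_real (R : realType) (x : R) : Prop :=
  exists2 f : nat -> rat, total_recursive_rat f &
    forall k : nat, `|x - ratr (f k)| < 2 ^- k.

Section finite_probability_space.
Variables (R : realType) (Omega : finType).
Implicit Types P X : Omega -> R.

Definition finite_probability_space P : Prop :=
  (forall a, 0 <= P a) /\ \sum_a P a = 1.

Definition mean P X : R := \sum_a X a * P a.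

Definition var P X : R := \sum_a (X a - mean P X) ^+ 2 * P a.

End finite_probability_space.

(* The sequence alpha(1) alpha(2) ... is the function i |-> alpha(i + 1). *)
Definition prefix_set (Omega : alphabetType) (S : set (seq Omega)) :
    set (nat -> Omega) :=
  [set alpha | exists n, S (mkseq alpha n)].

Notation infinite_sequence Omega :=
  (g_sigma_algebraType (range (@prefix_set Omega))).

Definition bernoulli_measure (R : realType) (Omega : alphabetType)
    (P : Omega -> R) (lam : probability (infinite_sequence Omega) R) : Prop :=
  forall s : seq Omega, lam (prefix_set [set s]) = (\prod_(a <- s) P a)%:E.

Section martin_lof.
Variables (R : realType) (Omega : alphabetType).
Variable lam : probability (infinite_sequence Omega) R.
Implicit Type C : set (nat * seq Omega).

(* (n, a_1 ... a_m) is coded by n followed by the ranks of the letters in the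
   enumeration of Omega. *)
Definition code_pair (u : nat * seq Omega) : seq nat :=
  u.1 :: [seq nat_of_ord (enum_rank a) | a <- u.2].

Definition test_section C (n : nat) : set (seq Omega) := [set s | C (n, s)].

Definition martin_lof_test C : Prop :=
  [/\ forall u, C u -> (0 < u.1)%N,
      recursively_enumerable (code_pair @` C)
    & forall n, (0 < n)%N ->
        (lam (prefix_set (test_section C n)) < (2 ^- n)%:E)%E].

Definition passes (alpha : nat -> Omega) C : Prop :=
  exists2 n, (0 < n)%N & ~ prefix_set (test_section C n) alpha.

Definition martin_lof_random (alpha : nat -> Omega) : Prop :=
  forall C, martin_lof_test C -> passes alpha C.

End martin_lof.

(* Main.v *)
(** A random sequence avoids every effectively null set, so each implication
    amounts to building one Martin-Löf test.

    If [t > 2], it suffices to control the letter counts [N_a] of the prefix of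
    length [k].  With [4^j <= k < 4^(j+1)], Chernoff's bound at parameter [2^-j]
    shows that [|N_a - k P(a)|] is at least about [2^j j^2] with probability
    [O(exp (- j^2))], which is summable in [k]; the event is decidable once
    [P(a)] is replaced by a dyadic approximation of precision [2^-j].  Hence
    [|S_k - k E(X)| = O(sqrt k (log k)^2)] along a random sequence, which is
    eventually below [k / n] when [n^t <= k].

    If [t <= 2], then (i) applied to [n = i 8^j], [k = i^2 64^j] for [i = 1, 5, 7]
    bounds the difference between the sums of [X] over the two consecutive blocks
    delimited by [64^j], [25 * 64^j], [49 * 64^j] by [18 * 8^j].  The mean cancels
    because both blocks have length [24 * 64^j], so only approximations of [X] are
    needed.  Each such event has probability at most [1 - c] for a fixed [c > 0],
    and these events are independent for different [j], so requiring all of them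
    defines an effectively null set. *)
Require Import Defs.
From mathcomp Require Import ring lra zify.

Set Implicit Arguments.
Unset Strict Implicit.
Unset Printing Implicit Defensive.

Import Order.TTheory GRing.Theory Num.Theory.

(** * Recursive functions *)

Section recursive_closure.
Local Open Scope nat_scope.

Definition recursive n (f : n.-tuple nat -> nat) : Prop :=
  partial_recursive (fun x y => y = f x).

Definition recursive_map m n (h : m.-tuple nat -> n.-tuple nat) : Prop :=
  forall i, recursive (fun x => tnth (h x) i).

Definition ttail n (x : n.+1.-tuple nat) : n.-tuple nat := [tuple of behead x].

Lemma recursive_ext n (f g : n.-tuple nat -> nat) :
  recursive f -> f =1 g -> recursive g.
Proof. by move=> rf /funext <-. Qed.

Lemma recursive_subst m n (f : n.-tuple nat -> nat)
    (h : m.-tuple nat -> n.-tuple nat) :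
  recursive f -> recursive_map h -> recursive (fun x => f (h x)).
Proof.
move=> rf rh; rewrite /recursive.
(* The composition constructor quantifies over an intermediate tuple [z]; for total functions it can
   only be [h x]. *)
rewrite [X in partial_recursive X](_ : _ = fun x y =>
  exists2 z : n.-tuple nat, (forall i, tnth z i = tnth (h x) i) & y = f z).
  exact: (PR_comp rf rh).
apply/funext => x; apply/funext => y; apply/propext; split => [->|].
  by exists (h x).
by case=> z /eq_from_tnth -> ->.
Qed.

Lemma recursive_map_comp m n p (h : n.-tuple nat -> p.-tuple nat)
    (k : m.-tuple nat -> n.-tuple nat) :
  recursive_map h -> recursive_map k -> recursive_map (fun x => h (k x)).
Proof.
by move=> rh rk i; apply: (recursive_subst (f := fun x => tnth (h x) i)).
Qed.

Lemma recursive_map_id n : recursive_map (fun x : n.-tuple nat => x).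
Proof. exact: PR_proj. Qed.

Lemma recursive_thead n : recursive (fun x : n.+1.-tuple nat => thead x).
Proof. exact: PR_proj. Qed.

Lemma recursive_map_ttail n : recursive_map (@ttail n).
Proof.
move=> i; apply: recursive_ext (PR_proj (lift ord0 i)) _ => x.
by rewrite (tuple_eta x) tnthS; congr tnth; apply: val_inj.
Qed.

Lemma recursive_map_nil m : recursive_map (fun _ : m.-tuple nat => [tuple]).
Proof. by case. Qed.

Lemma recursive_map_cons m n (f : m.-tuple nat -> nat)
    (h : m.-tuple nat -> n.-tuple nat) :
  recursive f -> recursive_map h ->
  recursive_map (fun x => [tuple of f x :: h x]).
Proof.
move=> rf rh i; case: (unliftP ord0 i) => [j|] ->.
  by apply: recursive_ext (rh j) _ => x; rewrite tnthS.
by apply: recursive_ext rf _ => x; rewrite tnth0.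
Qed.

Lemma recursive_app (f : nat -> nat) m (g : m.-tuple nat -> nat) :
  total_recursive f -> recursive g -> recursive (fun x => f (g x)).
Proof.
move=> rf rg; apply: (recursive_subst rf (h := fun x => [tuple g x])).
exact: (recursive_map_cons rg (@recursive_map_nil m)).
Qed.

Lemma recursive_succ m (f : m.-tuple nat -> nat) :
  recursive f -> recursive (fun x => (f x).+1).
Proof. exact: (recursive_app (f := succn) PR_succ). Qed.

Lemma recursive_const m c : recursive (fun _ : m.-tuple nat => c).
Proof. by elim: c => [|c IH]; [exact: PR_zero | exact: recursive_succ]. Qed.

Lemma recursive_iteri n (b g : n.-tuple nat -> nat)
    (h : nat -> nat -> n.-tuple nat -> nat) :
  recursive b -> recursive g ->
  recursive (fun y : n.+2.-tuple nat =>
    h (thead y) (thead (ttail y)) (ttail (ttail y))) ->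
  recursive (fun x => iteri (b x) (fun i z => h i z x) (g x)).
Proof.
move=> rb rg rh.
have rec : recursive (fun x : n.+1.-tuple nat =>
    iteri (thead x) (fun i z => h i z (ttail x)) (g (ttail x))).
  rewrite /recursive; have := PR_rec rg rh; congr partial_recursive.
  apply/funext => x; apply/funext => y; apply/propext.
  rewrite -/(ttail x); elim: (thead x) y => //= k IH y.
  have e z : [tuple of k :: z :: ttail x] =
    [tuple of k :: [tuple of z :: ttail x]] by apply: val_inj.
  have tt z : ttail [tuple of z :: ttail x] = ttail x by apply: val_inj.
  have tk z : ttail [tuple of k :: z :: ttail x] = [tuple of z :: ttail x].
    exact: val_inj.
  split=> [[z /IH -> ->]|->].
    by rewrite tk tt !theadE.
  eexists; first by apply/IH.
  by rewrite tk tt !theadE.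
apply: recursive_ext (recursive_subst rec (h := fun x => [tuple of b x :: x]) _) _.
  exact: recursive_map_cons rb (@recursive_map_id n).
move=> x; rewrite theadE; congr (iteri _ _ (g _)); last exact: val_inj.
by apply/funext => i; apply/funext => z; congr h; apply: val_inj.
Qed.

Lemma recursive_iter n (b g : n.-tuple nat -> nat)
    (h : nat -> n.-tuple nat -> nat) :
  recursive b -> recursive g ->
  recursive (fun y : n.+1.-tuple nat => h (thead y) (ttail y)) ->
  recursive (fun x => iter (b x) (fun z => h z x) (g x)).
Proof.
move=> rb rg rh; apply: recursive_ext (recursive_iteri (h := fun _ => h) rb rg _) _.
  exact: (recursive_subst rh (@recursive_map_ttail _)).
by move=> x; elim: (b x) => //= k ->.
Qed.

End recursive_closure.

Ltac recursive_leaf := first [ assumption | exact: recursive_thead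
  | exact: recursive_const | exact: PR_proj
  | apply: recursive_subst;
     [ first [assumption | exact: recursive_thead]
     | repeat first [exact: recursive_map_ttail | assumption
                    | apply: recursive_map_comp] ] ].

(** * Arithmetic, bounded sums and decidable comparisons *)

Section recursive_arithmetic.
Local Open Scope nat_scope.

Lemma recursive_add n (f g : n.-tuple nat -> nat) :
  recursive f -> recursive g -> recursive (fun x => f x + g x).
Proof.
move=> rf rg.
apply: recursive_ext (recursive_iter (h := fun z _ => z.+1) rg rf _) _.
  by apply: recursive_succ; recursive_leaf.
by move=> x; rewrite iter_succn.
Qed.

Lemma recursive_pred n (f : n.-tuple nat -> nat) :
  recursive f -> recursive (fun x => (f x).-1).
Proof.
move=> rf; have r0 := @recursive_const n 0.
(* The step returns the counter, so [k > 0] rounds end with the value [k - 1], and no round leaves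
   0. *)
apply: recursive_ext (recursive_iteri (h := fun i _ _ => i) rf r0 _) _.
  by recursive_leaf.
by move=> x; case: (f x).
Qed.

Lemma recursive_sub n (f g : n.-tuple nat -> nat) :
  recursive f -> recursive g -> recursive (fun x => f x - g x).
Proof.
move=> rf rg.
apply: recursive_ext (recursive_iter (h := fun z _ => z.-1) rg rf _) _.
  by apply: recursive_pred; recursive_leaf.
by move=> x; rewrite iter_predn.
Qed.

Lemma recursive_mul n (f g : n.-tuple nat -> nat) :
  recursive f -> recursive g -> recursive (fun x => f x * g x).
Proof.
move=> rf rg; have r0 := @recursive_const n 0.
apply: recursive_ext (recursive_iter (h := fun z x => f x + z) rg r0 _) _.
  by apply: recursive_add; recursive_leaf.
by move=> x; rewrite iter_addn_0.
Qed.

Lemma recursive_exp n (f g : n.-tuple nat -> nat) :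
  recursive f -> recursive g -> recursive (fun x => f x ^ g x).
Proof.
move=> rf rg; have r1 := @recursive_const n 1.
apply: recursive_ext (recursive_iter (h := fun z x => f x * z) rg r1 _) _.
  by apply: recursive_mul; recursive_leaf.
by move=> x; elim: (g x) => //= k ->; rewrite expnS.
Qed.

Lemma recursive_sum n (F : nat -> n.-tuple nat -> nat) (b : n.-tuple nat -> nat) :
  recursive b -> recursive (fun y : n.+1.-tuple nat => F (thead y) (ttail y)) ->
  recursive (fun x => \sum_(0 <= i < b x) F i x).
Proof.
move=> rb rF; have r0 := @recursive_const n 0.
apply: recursive_ext
  (recursive_iteri (h := fun i z x => z + F i x) rb r0 _) _.
  apply: recursive_add; first by recursive_leaf.
  apply: recursive_ext (recursive_subst rF (h := fun y =>
    [tuple of thead y :: ttail (ttail y)]) _) _ => [|x].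
    apply: recursive_map_cons; first by recursive_leaf.
    by apply: recursive_map_comp; exact: recursive_map_ttail.
  by rewrite theadE; congr F; apply: val_inj.
move=> x; elim: (b x) => [|k IH] /=; first by rewrite big_geq.
by rewrite big_nat_recr //= IH.
Qed.

Lemma recursive_big n (I : Type) (r : seq I) (F : I -> n.-tuple nat -> nat) :
  (forall a, recursive (F a)) -> recursive (fun x => \sum_(a <- r) F a x).
Proof.
move=> rF; elim: r => [|a r IH].
  by apply: recursive_ext (recursive_const n 0) _ => x; rewrite big_nil.
by apply: recursive_ext (recursive_add (rF a) IH) _ => x; rewrite big_cons.
Qed.

Lemma recursive_leq n (f g : n.-tuple nat -> nat) :
  recursive f -> recursive g -> recursive (fun x => nat_of_bool (f x <= g x)).
Proof.
move=> rf rg; have r1 := @recursive_const n 1.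
(* With truncated subtraction, [1 - (f - g)] is the truth value of [f <= g]. *)
apply: recursive_ext (recursive_sub r1 (recursive_sub rf rg)) _ => x.
by rewrite /leq; case: (f x - g x).
Qed.

Lemma recursive_and n (p q : n.-tuple nat -> bool) :
  recursive p -> recursive q -> recursive (fun x => nat_of_bool (p x && q x)).
Proof.
by move=> rp rq; apply: recursive_ext (recursive_mul rp rq) _ => x; rewrite mulnb.
Qed.

Lemma recursive_eq n (f g : n.-tuple nat -> nat) :
  recursive f -> recursive g -> recursive (fun x => nat_of_bool (f x == g x)).
Proof.
move=> rf rg.
apply: recursive_ext (recursive_and (recursive_leq rf rg) (recursive_leq rg rf)) _.
by move=> x; rewrite eqn_leq.
Qed.

Lemma recursive_all n (p : nat -> n.-tuple nat -> bool) (b : n.-tuple nat -> nat) :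
  recursive b ->
  recursive (fun y : n.+1.-tuple nat => nat_of_bool (p (thead y) (ttail y))) ->
  recursive (fun x => nat_of_bool (all (p^~ x) (iota 0 (b x)))).
Proof.
move=> rb rp; have r0 := @recursive_const n 0.
(* The sum counts the indices at which [p] fails. *)
apply: recursive_ext (recursive_eq (recursive_sum
  (F := fun i x => 1 - p i x) rb _) r0) _.
  by apply: recursive_sub => //; exact: recursive_const.
move=> x; congr nat_of_bool; rewrite /index_iota subn0.
elim: (iota _ _) => [|i s IH]; rewrite ?big_nil // big_cons addn_eq0 IH /=.
by case: (p i x).
Qed.

(** The quotient is the number of positive multiples of the divisor up to the dividend; writing the
    divisor as a successor keeps it non-zero. *)
Lemma recursive_div n (f g : n.-tuple nat -> nat) :
  recursive f -> recursive g -> recursive (fun x => f x %/ (g x).+1).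
Proof.
move=> rf rg.
apply: recursive_ext (recursive_sum
  (F := fun i x => i.+1 * (g x).+1 <= f x) rf _) _.
  apply: recursive_leq; last by recursive_leaf.
  by apply: recursive_mul; apply: recursive_succ; recursive_leaf.
move=> x; under eq_bigr do rewrite -leq_divRL //.
rewrite -{1}(subnKC (leq_div (f x) (g x).+1)).
set d := _ %/ _; rewrite (big_cat_nat _ (n := d)) ?leq_addr //=.
rewrite (eq_big_nat _ _ (F2 := fun=> 1)) => [|i /andP[_ ->]//].
rewrite sum_nat_const_nat subn0 muln1 [X in _ + X]big1_seq ?addn0 // => i.
by rewrite mem_index_iota => /and3P[_ di _]; rewrite ltnNge di.
Qed.

(** The logarithm is the number of [i] with [p ^ i.+1 <= f x], and all of them are below [f x]. *)
Lemma recursive_trunc_log n p (f : n.-tuple nat -> nat) :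
  1 < p -> recursive f -> recursive (fun x => trunc_log p (f x)).
Proof.
move=> p1 rf.
apply: recursive_ext (recursive_sum (F := fun i x => p ^ i.+1 <= f x) rf _) _.
  apply: recursive_leq; last by recursive_leaf.
  apply: recursive_exp; first exact: recursive_const.
  by apply: recursive_succ; recursive_leaf.
move=> x; have [-> |f0] := posnP (f x); first by rewrite big_geq // trunc_log0.
have le k : (p ^ k <= f x) = (k <= trunc_log p (f x)).
  apply/idP/idP; first exact: trunc_log_max.
  by move=> kl; apply: leq_trans (trunc_logP p1 f0); rewrite leq_exp2l.
under eq_bigr do rewrite le.
have dl : trunc_log p (f x) <= f x.
  by rewrite ltnW // (leq_trans (ltn_expl _ p1)) ?trunc_logP.
rewrite -{1}(subnKC dl).
set d := trunc_log _ _; rewrite (big_cat_nat _ (n := d)) ?leq_addr //=.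
rewrite (eq_big_nat _ _ (F2 := fun=> 1)) => [|i /andP[_ ->]//].
rewrite sum_nat_const_nat subn0 muln1 [X in _ + X]big1_seq ?addn0 // => i.
by rewrite mem_index_iota => /and3P[_ di _]; rewrite ltnNge di.
Qed.

End recursive_arithmetic.

(** * Decoding finite sequences and enumerating decidable tests *)

Section decoding.
Local Open Scope classical_set_scope.
Local Open Scope nat_scope.

(** [CodeSeq.code (i :: s)] equals [2 ^ i * (2 * code s + 1)]. A bounded search over the pairs
    [(i, j)] finds the only one that represents [k], and the code 0 of the empty sequence yields
    0. *)
Definition code_head (k : nat) : nat :=
  \sum_(0 <= i < k) \sum_(0 <= j < k) i * (k == 2 ^ i * (2 * j).+1).

Definition code_tail (k : nat) : nat :=
  \sum_(0 <= i < k) \sum_(0 <= j < k) j * (k == 2 ^ i * (2 * j).+1).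

(** Both sides are codes of non-empty sequences, so the injectivity of [CodeSeq.code] applies. *)
Lemma pow2_odd_inj i j i' j' :
  2 ^ i * (2 * j).+1 = 2 ^ i' * (2 * j').+1 -> i = i' /\ j = j'.
Proof.
have e u v : 2 ^ u * (2 * v).+1 = CodeSeq.code (u :: CodeSeq.decode v).
  by rewrite /= CodeSeq.decodeK mul2n.
rewrite !e => /(can_inj CodeSeq.codeK)[-> /(can_inj CodeSeq.decodeK) ->].
by [].
Qed.

Lemma big_code (F : nat -> nat -> nat) i s :
  \sum_(0 <= i' < CodeSeq.code (i :: s))
     \sum_(0 <= j < CodeSeq.code (i :: s))
       F i' j * (CodeSeq.code (i :: s) == 2 ^ i' * (2 * j).+1) =
  F i (CodeSeq.code s).
Proof.
have lti : i < CodeSeq.code (i :: s) by have /= /andP[] := CodeSeq.ltn_code (i :: s).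
have ltj : CodeSeq.code s < CodeSeq.code (i :: s).
  by rewrite /= -[X in X < _]mul1n -ltn_double /= -mul2n; nia.
have e : CodeSeq.code (i :: s) = 2 ^ i * (2 * CodeSeq.code s).+1.
  by rewrite /= mul2n.
move: (CodeSeq.code (i :: s)) (CodeSeq.code s) lti ltj e => K k lti ltj e.
rewrite (bigD1_seq i) ?mem_index_iota ?iota_uniq //=.
rewrite (bigD1_seq k) ?mem_index_iota ?iota_uniq //= {1}e eqxx muln1.
rewrite big1 ?addn0 => [|j /negP nj]; last first.
  case: eqP => [|_]; last by rewrite muln0.
  by rewrite {1}e => /pow2_odd_inj[_ ej]; case: nj; apply/eqP.
rewrite big1 ?addn0 // => i' /negP ni; apply: big1 => j _.
case: eqP => [|_]; last by rewrite muln0.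
by rewrite {1}e => /pow2_odd_inj[ei _]; case: ni; apply/eqP.
Qed.

Lemma code_headE s : code_head (CodeSeq.code s) = head 0 s.
Proof.
case: s => [|i s]; first by rewrite /code_head /= big_geq.
by rewrite /code_head (big_code (fun i _ => i)).
Qed.

Lemma code_tailE s : code_tail (CodeSeq.code s) = CodeSeq.code (behead s).
Proof.
case: s => [|i s]; first by rewrite /code_tail /= big_geq.
by rewrite /code_tail (big_code (fun _ j => j)).
Qed.

Lemma iter_code_tail i s :
  iter i code_tail (CodeSeq.code s) = CodeSeq.code (drop i s).
Proof.
elim: i => [|i IH] /=; first by rewrite drop0.
by rewrite IH code_tailE -drop1 drop_drop add1n.
Qed.

Lemma recursive_code_head n (f : n.-tuple nat -> nat) :
  recursive f -> recursive (fun x => code_head (f x)).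
Proof.
move=> rf; apply: recursive_sum => //; apply: recursive_sum.
  by recursive_leaf.
apply: recursive_mul; first by recursive_leaf.
apply: recursive_eq; first by recursive_leaf.
apply: recursive_mul.
  by apply: recursive_exp; recursive_leaf.
by apply: recursive_succ; apply: recursive_mul; recursive_leaf.
Qed.

Lemma recursive_code_tail n (f : n.-tuple nat -> nat) :
  recursive f -> recursive (fun x => code_tail (f x)).
Proof.
move=> rf; apply: recursive_sum => //; apply: recursive_sum.
  by recursive_leaf.
apply: recursive_mul; first by recursive_leaf.
apply: recursive_eq; first by recursive_leaf.
apply: recursive_mul.
  by apply: recursive_exp; recursive_leaf.
by apply: recursive_succ; apply: recursive_mul; recursive_leaf.
Qed.

Lemma recursive_code_drop n (f g : n.-tuple nat -> nat) :
  recursive f -> recursive g ->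
  recursive (fun x => CodeSeq.code (drop (g x) (CodeSeq.decode (f x)))).
Proof.
move=> rf rg.
apply: recursive_ext (recursive_iter (h := fun z _ => code_tail z) rg rf _) _.
  by apply: recursive_code_tail; recursive_leaf.
by move=> x; rewrite -iter_code_tail CodeSeq.decodeK.
Qed.

Lemma recursive_nth n (f g : n.-tuple nat -> nat) :
  recursive f -> recursive g ->
  recursive (fun x => nth 0 (CodeSeq.decode (f x)) (g x)).
Proof.
move=> rf rg.
apply: recursive_ext (recursive_code_head (recursive_code_drop rf rg)) _ => x.
by rewrite code_headE -nth0 nth_drop addn0.
Qed.

Lemma leq_size_code s : size s <= CodeSeq.code s.
Proof.
elim: s => //= i s IH; have : 0 < 2 ^ i by rewrite expn_gt0.
by rewrite -mul2n; nia.
Qed.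

Lemma recursive_size n (f : n.-tuple nat -> nat) :
  recursive f -> recursive (fun x => size (CodeSeq.decode (f x))).
Proof.
move=> rf; have r0 := recursive_const n 0.
(* The size is the number of [i] for which dropping [i] entries leaves a non-empty sequence, that
   is, a positive code. *)
apply: recursive_ext (recursive_sum (F := fun i x =>
  1 <= CodeSeq.code (drop i (CodeSeq.decode (f x)))) rf _) _.
  apply: recursive_leq; first exact: recursive_const.
  by apply: recursive_code_drop; recursive_leaf.
move=> x; set s := CodeSeq.decode _.
have -> : f x = CodeSeq.code s by rewrite CodeSeq.decodeK.
rewrite -(subnKC (leq_size_code s)) (big_cat_nat _ (n := size s)) ?leq_addr //=.
rewrite (eq_big_nat _ _ (F2 := fun=> 1)) => [|i /andP[_ il]]; last first.
  by rewrite (drop_nth 0) //= muln_gt0 expn_gt0.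
rewrite sum_nat_const_nat subn0 muln1 big1_seq ?addn0 // => i.
by rewrite mem_index_iota => /and3P[_ di _]; rewrite drop_oversize.
Qed.

Definition recursive_pred_seq (Q : pred (seq nat)) : Prop :=
  recursive (fun x : 1.-tuple nat => nat_of_bool (Q (CodeSeq.decode (thead x)))).

(** A non-empty decidable set is the range of the function that keeps the members and sends every
    other sequence to a fixed member [s0]. *)
Lemma recursively_enumerable_pred (Q : pred (seq nat)) :
  recursive_pred_seq Q -> recursively_enumerable [set s | Q s].
Proof.
move=> rQ; have [[s0 Qs0]|Q0] := pselect (exists s, Q s); last first.
  by left; apply/seteqP; split => // s Qs; apply: Q0; exists s.
right; exists (fun k => Q (CodeSeq.decode k) * k +
  (1 - Q (CodeSeq.decode k)) * CodeSeq.code s0).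
  apply: recursive_add; apply: recursive_mul => //.
  - exact: recursive_thead.
  - by apply: recursive_sub => //; exact: recursive_const.
  - exact: recursive_const.
apply/seteqP; split => s /=.
  move=> Qs; exists (CodeSeq.code s) => //.
  by rewrite CodeSeq.codeK Qs mul1n subnn addn0 CodeSeq.codeK.
case=> k _ <-; case: (boolP (Q (CodeSeq.decode k))) => Qk.
  by rewrite mul1n subnn addn0.
by rewrite mul0n mul1n add0n CodeSeq.codeK.
Qed.

Variable Omega : alphabetType.

Lemma recursively_enumerable_test (Q : pred (seq nat)) :
  recursive_pred_seq Q ->
  recursively_enumerable
    (@code_pair Omega @` [set u | (0 < u.1) && Q (code_pair u)]).
Proof.
move=> rQ.
(* A sequence codes a pair when all entries after the first are ranks of letters. The default value
   0 of [nth] makes the positivity of the first entry exclude the empty sequence. *)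
pose valid s := all (fun i => nth 0 s i.+1 < #|Omega|) (iota 0 (size s).-1).
have -> : @code_pair Omega @` [set u | (0 < u.1) && Q (code_pair u)] =
   [set s | [&& 0 < nth 0 s 0, valid s & Q s]].
  apply/seteqP; split => s /=.
    case=> -[n t] /= /andP[n0 Qs] <-; rewrite n0 Qs andbT /=.
    apply/allP => i; rewrite mem_iota /= add0n size_map => it.
    have [a _] : exists a : Omega, true by exists point.
    by rewrite (nth_map a) // ltn_ord.
  case: s => //= n t /and3P[n0 /allP vt Qt].
  have rK : [seq nat_of_ord (enum_rank a)
              | a <- [seq nth point (enum Omega) r | r <- t]] = t.
    rewrite -map_comp -[RHS]map_id; apply/eq_in_map => r rt /=.
    have [i it <-] := nthP 0 rt; have := vt i.
    rewrite mem_iota add0n it => /(_ isT) lt.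
    by rewrite -(enum_val_nth _ (Ordinal lt)) enum_valK.
  by exists (n, [seq nth point (enum Omega) r | r <- t]);
     rewrite /code_pair /= rK // n0.
apply: recursively_enumerable_pred.
apply: recursive_and.
  apply: recursive_leq; first exact: recursive_const.
  by apply: recursive_nth; recursive_leaf.
apply: recursive_and => //; apply: recursive_all.
  by apply: recursive_pred; apply: recursive_size; recursive_leaf.
apply: recursive_leq; last exact: recursive_const.
apply: recursive_succ; apply: recursive_nth; first by recursive_leaf.
by apply: recursive_succ; recursive_leaf.
Qed.

End decoding.

(** * Dyadic approximations of computable reals *)

Section dyadic_approximation.
Local Open Scope ring_scope.

(** A denominator known in advance and two natural numerators turn the later tests into comparisons
    of natural numbers. One [2 ^- k] of the error comes from the given approximation, the other from
    rounding. *)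
Lemma computable_real_dyadic (R : realType) (x : R) :
  computable_real x -> exists A B : nat -> nat,
    [/\ total_recursive A, total_recursive B &
     forall k, `|x - ((A k)%:R - (B k)%:R) / 2 ^+ k| <= 2 / 2 ^+ k].
Proof.
case=> f [a [b [c [ra rb rc fE]]]] fx.
have rd (u : nat -> nat) : total_recursive u ->
    total_recursive (fun k => (u k * 2 ^ k) %/ (c k).+1)%N.
  move=> ru; apply: recursive_div; last exact: rc.
  apply: recursive_mul => //; apply: recursive_exp; first exact: recursive_const.
  exact: recursive_thead.
exists (fun k => (a k * 2 ^ k) %/ (c k).+1)%N, (fun k => (b k * 2 ^ k) %/ (c k).+1)%N.
split; [exact: rd| exact: rd|] => k.
have cp : 0 < (c k).+1%:R :> R by rewrite ltr0n.
have p2 : 0 < 2 ^+ k :> R by rewrite exprn_gt0.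
(* Both numerators are rounded down by less than 1, so their difference moves by less than 1 as
   well. *)
have flr (u : nat) : let q := ((u * 2 ^ k) %/ (c k).+1)%N in
   q%:R <= (u%:R * 2 ^+ k / (c k).+1%:R : R) < q%:R + 1.
  move=> q; have -> : u%:R * 2 ^+ k = (u * 2 ^ k)%:R :> R by rewrite natrM natrX.
  rewrite ler_pdivlMr // ltr_pdivrMr // natr1 -!natrM ler_nat ltr_nat.
  by rewrite leq_trunc_div ltn_ceil.
have /andP[a1 a2] := flr (a k); have /andP[b1 b2] := flr (b k).
move: a1 a2 b1 b2; set qa := (_ %/ _)%N; set qb := (_ %/ _)%N => a1 a2 b1 b2.
have := fx k; rewrite fE fmorph_div rmorphB /= !ratr_nat => fk.
have p2i : 0 < (2 ^+ k)^-1 :> R by rewrite invr_gt0.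
have -> : 2 / 2 ^+ k = (2 ^+ k)^-1 + (2 ^+ k)^-1 :> R by rewrite mulr_natl mulr2n.
set y := (_ - _) / _ in fk.
have -> : x - (qa%:R - qb%:R) / 2 ^+ k = (x - y) + (y - (qa%:R - qb%:R) / 2 ^+ k).
  by rewrite addrA subrK.
apply: le_trans (ler_normD _ _) _; apply: lerD; first exact: ltW.
rewrite -[leRHS]mul1r ler_pdivlMr // -{2}(gtr0_norm p2) -normrM.
have -> : (y - (qa%:R - qb%:R) / 2 ^+ k) * 2 ^+ k =
  ((a k)%:R * 2 ^+ k / (c k).+1%:R - qa%:R) - ((b k)%:R * 2 ^+ k / (c k).+1%:R - qb%:R).
  rewrite mulrBl divfK ?gt_eqF // /y; ring.
move: a1 a2 b1 b2; set u := _ / _; set v := (b k)%:R * _ / _ => a1 a2 b1 b2.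
by rewrite ler_norml; apply/andP; split; lra.
Qed.

End dyadic_approximation.

Ltac recursive_tac := repeat lazymatch goal with
  | |- recursive (fun _ => ?c) => exact: recursive_const
  | H : total_recursive ?f |- recursive (fun x => ?f (@?g x)) =>
      apply: (recursive_app H)
  | |- recursive (fun x => nat_of_bool (@?p x && @?q x)) => apply: recursive_and
  | |- recursive (fun x => nat_of_bool (@?f x == @?g x)) => apply: recursive_eq
  | |- recursive (fun x => nat_of_bool (leq (@?f x) (@?g x))) => apply: recursive_leq
  | |- recursive (fun x => nat_of_bool (all (@?p x) (iota 0 (@?b x)))) =>
      apply: recursive_all
  | |- recursive (fun x => addn (@?f x) (@?g x)) => apply: recursive_add
  | |- recursive (fun x => subn (@?f x) (@?g x)) => apply: recursive_sub
  | |- recursive (fun x => muln (@?f x) (@?g x)) => apply: recursive_mul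
  | |- recursive (fun x => expn (@?f x) (@?g x)) => apply: recursive_exp
  | |- recursive (fun x => predn (@?f x)) => apply: recursive_pred
  | |- recursive (fun x => trunc_log ?p (@?f x)) => apply: recursive_trunc_log
  | |- recursive (fun x => size (CodeSeq.decode (@?f x))) => apply: recursive_size
  | |- recursive (fun x => nth 0%N (CodeSeq.decode (@?f x)) (@?g x)) =>
      apply: recursive_nth
  | |- recursive (fun x => \sum_(0%N <= i < @?b x) _) => apply: recursive_sum
  | |- recursive (fun x => \sum_(a <- _) _) => apply: recursive_big => ?
  | |- recursive (fun x => S (@?f x)) =>
      first [exact: recursive_const | apply: recursive_succ]
  | |- recursive _ => first [recursive_leaf | fail]
  end.

(** * Words of independent letters *)

Section expectation.
Local Open Scope ring_scope.
Variables (R : realType) (Omega : finType).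
Implicit Types (P Z w : Omega -> R) (F G : seq Omega -> R).

(** A finite sum over the words of length [k]. The weights are arbitrary, so that tilted weights are
    covered too. *)
Fixpoint expectation P k F : R :=
  if k is k'.+1 then \sum_a P a * expectation P k' (fun s => F (a :: s))
  else F [::].

Definition prob P k (S : pred (seq Omega)) : R :=
  expectation P k (fun s => (S s)%:R).

Lemma eq_expectation P k F G :
  (forall s, size s = k -> F s = G s) -> expectation P k F = expectation P k G.
Proof.
elim: k F G => [|k IH] F G FG /=; first exact: FG.
by apply: eq_bigr => a _; congr (_ * _); apply: IH => s sk; apply: FG; rewrite /= sk.
Qed.

Lemma expectationD P k F G :
  expectation P k (fun s => F s + G s) = expectation P k F + expectation P k G.
Proof.
elim: k F G => [//|k IH] F G /=; rewrite -big_split /=.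
by apply: eq_bigr => a _; rewrite IH mulrDr.
Qed.

Lemma expectationZ P k c F :
  expectation P k (fun s => c * F s) = c * expectation P k F.
Proof.
elim: k F => [//|k IH] F /=; rewrite mulr_sumr.
by apply: eq_bigr => a _; rewrite IH mulrCA.
Qed.

Lemma expectation_cat P m l F :
  expectation P (m + l) F =
  expectation P m (fun s => expectation P l (fun u => F (s ++ u))).
Proof.
elim: m F => [//|m IH] F; rewrite addSn /=.
by apply: eq_bigr => a _; rewrite IH.
Qed.

Lemma expectation_prod P k w :
  expectation P k (fun s => \prod_(a <- s) w a) = (\sum_a P a * w a) ^+ k.
Proof.
elim: k => [|k IH] /=; first by rewrite big_nil.
rewrite exprS mulr_suml; apply: eq_bigr => a _.
rewrite -mulrA -IH -[in RHS]expectationZ; congr (_ * _).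
by apply: eq_expectation => s _; rewrite big_cons.
Qed.

(** Change of measure: the density of the tilted weights is the product of the letter factors. *)
Lemma expectation_tilt P w k F :
  expectation (fun a => P a * w a) k F =
  expectation P k (fun s => F s * \prod_(a <- s) w a).
Proof.
elim: k F => [|k IH] F /=; first by rewrite big_nil mulr1.
apply: eq_bigr => a _; rewrite IH -mulrA -[in LHS]expectationZ; congr (_ * _).
by apply: eq_expectation => s _; rewrite big_cons mulrCA.
Qed.

Section probability_weights.
Variable P : Omega -> R.
Hypothesis fpsP : finite_probability_space P.

Lemma expectation_le k F G :
  (forall s, size s = k -> F s <= G s) -> expectation P k F <= expectation P k G.
Proof.
elim: k F G => [|k IH] F G FG /=; first exact: FG.
apply: ler_sum => a _; apply: ler_wpM2l; first exact: (proj1 fpsP).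
by apply: IH => s sk; apply: FG; rewrite /= sk.
Qed.

Lemma expectation_cst k c : expectation P k (fun=> c) = c.
Proof.
elim: k => [//|k IH] /=; rewrite -[RHS]mul1r -(proj2 fpsP) mulr_suml.
by apply: eq_bigr => a _; rewrite IH.
Qed.

Lemma expectation_sum k Z : \sum_a P a * Z a = 0 ->
  expectation P k (fun s => \sum_(a <- s) Z a) = 0.
Proof.
move=> Z0; elim: k => [|k IH] /=; first by rewrite big_nil.
rewrite -[RHS]Z0; apply: eq_bigr => a _; congr (_ * _).
rewrite -[RHS]addr0 -[X in _ + X]IH -{1}(expectation_cst k (Z a)) -expectationD.
by apply: eq_expectation => s _; rewrite big_cons.
Qed.

(** Splitting off the first letter leaves a cross term that vanishes because [Z] is centred. *)
Lemma expectation_sqr_sum k Z : \sum_a P a * Z a = 0 ->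
  expectation P k (fun s => (\sum_(a <- s) Z a) ^+ 2) =
  k%:R * \sum_a P a * Z a ^+ 2.
Proof.
move=> Z0; elim: k => [|k IH] /=; first by rewrite big_nil expr0n mul0r.
rewrite -natr1 mulrDl mul1r -IH addrC -[X in _ = _ + X]mul1r -(proj2 fpsP).
rewrite mulr_suml -big_split /=; apply: eq_bigr => a _.
rewrite -mulrDr; congr (_ * _).
transitivity (expectation P k (fun s => Z a ^+ 2 +
    (2 * Z a * (\sum_(b <- s) Z b) + (\sum_(b <- s) Z b) ^+ 2))).
  by apply: eq_expectation => s _; rewrite big_cons; ring.
rewrite !expectationD expectation_cst expectationZ expectation_sum //.
by rewrite mulr0 add0r.
Qed.

Lemma chebyshev_sum k Z (y : R) : \sum_a P a * Z a = 0 -> 0 < y ->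
  prob P k (fun s => y <= `|\sum_(a <- s) Z a|) <=
  k%:R * (\sum_a P a * Z a ^+ 2) / y ^+ 2.
Proof.
move=> Z0 y0; rewrite -expectation_sqr_sum // mulrC -expectationZ.
apply: expectation_le => s _; case: (lerP y _) => [ys|_] /=; last first.
  by rewrite mulr_ge0 ?invr_ge0 ?sqr_ge0.
rewrite mulrC ler_pdivlMr ?exprn_gt0 // mul1r -[leRHS]real_normK ?num_real //.
by rewrite ler_pXn2r ?nnegrE // ltW.
Qed.

Lemma probC k (S : pred (seq Omega)) :
  prob P k (fun s => ~~ S s) = 1 - prob P k S.
Proof.
apply/eqP; rewrite eq_sym subr_eq -expectationD -[X in X == _](expectation_cst k).
by apply/eqP; apply: eq_expectation => s _; case: (S s); rewrite /= ?addr0 ?add0r.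
Qed.

(** From [1 - x <= expR (- x)] follows [(1 - x) * expR x <= 1], while [(1 - x) * (1 + x + 2 * x ^+
    2) = 1 + x ^+ 2 * (1 - 2 * x)] is at least 1. *)
Lemma expR_quadratic_bound (x : R) : x <= 1 / 2 -> expR x <= 1 + x + 2 * x ^+ 2.
Proof.
move=> x2; have : 1 - x <= expR (- x) by rewrite expR_ge1Dx.
rewrite expRN => ex.
have e0 := expR_gt0 x.
have : (1 - x) * expR x <= 1 by rewrite -ler_pdivlMr // mul1r.
move=> h; rewrite -(@ler_pM2l _ (1 - x)); last lra.
apply: le_trans h _; nra.
Qed.

(* Chernoff's method: [E exp(theta Z) <= 1 + 2 theta^2 <= exp(2 theta^2)]. *)
Lemma chernoff_sum k Z (x theta : R) :
  \sum_a P a * Z a = 0 -> (forall a, `|Z a| <= 1) -> 0 <= theta <= 1 / 2 ->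
  prob P k (fun s => x <= \sum_(a <- s) Z a) <=
  expR (2 * k%:R * theta ^+ 2 - theta * x).
Proof.
move=> Z0 Z1 /andP[t0 t2].
have mgf : \sum_a P a * expR (theta * Z a) <= expR (2 * theta ^+ 2).
  apply: (@le_trans _ _ (1 + 2 * theta ^+ 2)); last exact: expR_ge1Dx.
  apply: (@le_trans _ _ (\sum_a (P a + theta * (P a * Z a) + 2 * theta ^+ 2 * P a))).
    apply: ler_sum => a _.
    have /andP[za zb] : -1 <= Z a <= 1 by rewrite -ler_norml.
    have Pa := proj1 fpsP a.
    apply: (@le_trans _ _ (P a * (1 + theta * Z a + 2 * (theta * Z a) ^+ 2))).
      by apply: ler_wpM2l => //; apply: expR_quadratic_bound; nra.
    have z2 : (Z a) ^+ 2 <= 1 by nra.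
    have : P a * theta ^+ 2 * (Z a) ^+ 2 <= P a * theta ^+ 2.
      by rewrite ler_piMr // mulr_ge0 // sqr_ge0.
    nra.
  rewrite !big_split /= -!mulr_sumr Z0 (proj2 fpsP); lra.
apply: (@le_trans _ _ (expectation P k (fun s =>
    expR (- (theta * x)) * \prod_(a <- s) expR (theta * Z a)))).
  apply: expectation_le => s _.
  have -> : \prod_(a <- s) expR (theta * Z a) = expR (theta * \sum_(a <- s) Z a).
    rewrite mulr_sumr; elim: s => [|a s IH]; first by rewrite !big_nil expR0.
    by rewrite !big_cons expRD IH.
  rewrite -expRD; case: (lerP x _) => [xs|_] /=; last exact: expR_ge0.
  by rewrite -[leLHS]expR0 ler_expR addrC subr_ge0 ler_wpM2l.
rewrite expectationZ expectation_prod addrC expRD ler_wpM2l ?expR_ge0 //.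
have -> : 2 * k%:R * theta ^+ 2 = k%:R * (2 * theta ^+ 2) by ring.
rewrite expRM_natl lerXn2r ?nnegrE ?expR_ge0 //.
by apply: sumr_ge0 => a _; rewrite mulr_ge0 ?expR_ge0 // (proj1 fpsP).
Qed.

(** Union bound over the one-sided estimates for [Z] and [- Z]. *)
Lemma chernoff_abs_sum k Z (x theta : R) :
  \sum_a P a * Z a = 0 -> (forall a, `|Z a| <= 1) -> 0 <= theta <= 1 / 2 ->
  prob P k (fun s => x <= `|\sum_(a <- s) Z a|) <=
  2 * expR (2 * k%:R * theta ^+ 2 - theta * x).
Proof.
move=> Z0 Z1 t2.
apply: (@le_trans _ _ (expectation P k (fun s => (x <= \sum_(a <- s) Z a)%R%:R +
    (x <= \sum_(a <- s) - Z a)%R%:R))).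
  apply: expectation_le => s _; rewrite sumrN ler_normr.
  by do 2 case: (x <= _); rewrite /= ?lerDl ?addr0 ?add0r ?ler01.
rewrite expectationD mulr_natl mulr2n; apply: lerD; first exact: chernoff_sum.
apply: chernoff_sum => // [|a]; last by rewrite normrN.
by under eq_bigr do rewrite mulrN; rewrite sumrN Z0 oppr0.
Qed.

End probability_weights.

End expectation.

(** * Lower bounds for the probability of large sums *)

Section anticoncentration.
Local Open Scope ring_scope.
Variables (R : realType) (Omega : finType) (P : Omega -> R).
Hypothesis fpsP : finite_probability_space P.
Implicit Types (Z w : Omega -> R) (S T U : pred (seq Omega)).

Lemma prob_le k S T :
  (forall s, size s = k -> S s -> T s) -> prob P k S <= prob P k T.
Proof.
move=> ST; apply: expectation_le => // s sk.
by rewrite ler_nat; case: (boolP (S s)) => // /(ST _ sk) ->.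
Qed.

Lemma prob_ge0 k S : 0 <= prob P k S.
Proof. by rewrite -[leLHS](expectation_cst fpsP k); apply: expectation_le. Qed.

Lemma prob_le1 k S : prob P k S <= 1.
Proof.
by rewrite -[leRHS](expectation_cst fpsP k); apply: expectation_le => // s _;
   rewrite lern1 leq_b1.
Qed.

(** Independence of consecutive parts of a word. *)
Lemma prob_cat m l S T U :
  (forall s u, size s = m -> size u = l -> U (s ++ u) = S s && T u) ->
  prob P (m + l) U = prob P m S * prob P l T.
Proof.
move=> UST; rewrite /prob expectation_cat mulrC -expectationZ.
apply: eq_expectation => s sm; rewrite mulrC -expectationZ.
by apply: eq_expectation => u ul; rewrite UST // -natrM mulnb.
Qed.

(* Change of measure: under the tilted weights [P * (1 + theta Z)] with
   [theta = u / sqrt m] the sum of [Z] concentrates near [u v sqrt m], while the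
   density has second moment at most [exp (u^2 v)]. *)
Lemma sum_anticoncentration Z (K : R) : \sum_a P a * Z a = 0 ->
  0 < \sum_a P a * Z a ^+ 2 ->
  exists2 c : R, 0 < c & exists m0 : nat, forall m, (m0 <= m)%N ->
    c <= prob P m (fun s => K * Num.sqrt m%:R <= \sum_(a <- s) Z a).
Proof.
move=> Z0; set v := \sum_a P a * Z a ^+ 2 => v0.
pose K' : R := `|K|; have K0 : 0 <= K' by rewrite /K'.
(* The tilted mean [u v sqrt m] then exceeds [K' sqrt m] by [2 (1 + v) sqrt m], a margin wide enough
   for Chebyshev's inequality to leave probability 1/2. *)
pose u : R := (K' + 2 * (1 + v)) / v.
have u0 : 0 < u by rewrite divr_gt0 //; lra.
have uv : u * v = K' + 2 * (1 + v) by rewrite divfK // gt_eqF.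
pose b : R := 1 + \sum_a `|Z a|.
have b0 : 0 < b by rewrite ltr_pwDl ?sumr_ge0.
have Zb a : `|Z a| <= b.
  by rewrite /b (bigD1 a) //= addrCA lerDl addr_ge0 ?sumr_ge0.
have B0 : 0 < expR (u ^+ 2 * v) by exact: expR_gt0.
exists (1 / (4 * expR (u ^+ 2 * v))); first by rewrite divr_gt0 ?mulr_gt0.
(* For such [m], [theta * b <= 1 / 2], which keeps the density factors between 1/2 and 3/2. *)
have [m0 m0P] : exists m0 : nat, (2 * u * b) ^+ 2 < m0%:R.
  exists (Num.bound ((2 * u * b) ^+ 2)); apply: archi_boundP; exact: sqr_ge0.
exists m0 => m m0m; set r : R := Num.sqrt m%:R.
have ub0 : 0 < 2 * u * b by do 2?apply: mulr_gt0.
have rm : r ^+ 2 = m%:R by rewrite sqr_sqrtr.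
have rub : 2 * u * b <= r.
  rewrite -(@ler_pXn2r _ 2) ?nnegrE ?sqrtr_ge0 // ?ltW // rm.
  by rewrite (lt_le_trans m0P) // ler_nat.
have r0 : 0 < r by exact: lt_le_trans rub.
pose theta : R := u / r; have t0 : 0 < theta by rewrite divr_gt0.
have tr : theta * r = u by rewrite divfK // gt_eqF.
have tb : theta * b <= 1 / 2 by rewrite /theta mulrAC ler_pdivrMr //; lra.
pose w a := 1 + theta * Z a.
have wb a : 1 / 2 <= w a <= 3 / 2.
  have : `|theta * Z a| <= 1 / 2.
    by rewrite normrM gtr0_norm // (le_trans _ tb) // ler_wpM2l // ltW.
  by rewrite ler_norml /w; lra.
have P0 a : 0 <= P a by exact: (proj1 fpsP).
pose Q a := P a * w a.
have fpsQ : finite_probability_space Q.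
  split=> [a|]; first by rewrite mulr_ge0 //; have := wb a; lra.
  rewrite /Q; under eq_bigr do rewrite /w mulrDr mulr1 mulrCA.
  by rewrite big_split /= -mulr_sumr Z0 mulr0 addr0 (proj2 fpsP).
have QZ : \sum_a Q a * Z a = theta * v.
  under eq_bigr => a _.
    rewrite (_ : Q a * Z a = P a * Z a + theta * (P a * Z a ^+ 2)); last first.
      by rewrite /Q /w; ring.
    over.
  by rewrite big_split /= -mulr_sumr Z0 add0r.
pose Y a := Z a - theta * v.
have QY : \sum_a Q a * Y a = 0.
  under eq_bigr do rewrite /Y mulrBr.
  by rewrite sumrB QZ -mulr_suml (proj2 fpsQ) mul1r subrr.
(* The tilted variance is at most the tilted second moment of [Z], and [w <= 3 / 2]. *)
have QY2 : \sum_a Q a * Y a ^+ 2 <= 3 / 2 * v.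
  apply: (@le_trans _ _ (\sum_a Q a * Z a ^+ 2)).
    rewrite -subr_ge0 -sumrB.
    under eq_bigr => a _.
      rewrite (_ : _ - _ = 2 * (theta * v) * (Q a * Z a) - (theta * v) ^+ 2 * Q a);
        last by rewrite /Y; ring.
      over.
    rewrite sumrB -!mulr_sumr QZ (proj2 fpsQ) mulr1.
    by have := sqr_ge0 (theta * v); lra.
  rewrite mulr_sumr; apply: ler_sum => a _.
  have pz : 0 <= P a * Z a ^+ 2 by apply: mulr_ge0; rewrite ?sqr_ge0.
  by rewrite /Q mulrAC [leRHS]mulrC ler_wpM2l //; have /andP[] := wb a.
have mv : m%:R * (theta * v) = r * (K' + 2 * (1 + v)).
  by rewrite -rm -uv -tr; ring.
have yr : 0 < 2 * (1 + v) * r by rewrite mulr_gt0 //; lra.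
have cheb := chebyshev_sum fpsQ m QY yr.
have far : prob Q m (fun s => 2 * (1 + v) * r <= `|\sum_(a <- s) Y a|) <= 1 / 2.
  apply: le_trans cheb _; rewrite ler_pdivrMr ?exprn_gt0 //.
  rewrite (_ : (2 * (1 + v) * r) ^+ 2 = m%:R * (4 * (1 + v) ^+ 2)); last first.
    by rewrite -rm; ring.
  rewrite mulrCA ler_wpM2l // (le_trans QY2) //; nra.
have near : 1 / 2 <= prob Q m (fun s => K * r <= \sum_(a <- s) Z a).
  apply: (@le_trans _ _ (prob Q m (fun s =>
      ~~ (2 * (1 + v) * r <= `|\sum_(a <- s) Y a|)))).
    by rewrite probC //; lra.
  apply: expectation_le => // s sm; rewrite ler_nat -ltNge.
  case: ltrP => //= ; rewrite ltr_norml => /andP[+ _].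
  rewrite /Y sumrB big_const_seq count_predT sm iter_addr_0 -[_ *+ m]mulr_natl mv => h.
  rewrite lt0b; apply: (@le_trans _ _ (K' * r)).
    by rewrite ler_wpM2r ?ler_norm // ltW.
  by move: h; lra.
(* The second moment of the density factorizes as [(1 + theta ^+ 2 * v) ^+ m]. *)
have W2 : expectation P m (fun s => (\prod_(a <- s) w a) ^+ 2) <= expR (u ^+ 2 * v).
  rewrite (@eq_expectation _ _ P m _ (fun s => \prod_(a <- s) w a ^+ 2)); last first.
    by move=> s _; rewrite prodrXl.
  rewrite expectation_prod.
  have -> : \sum_a P a * w a ^+ 2 = 1 + theta ^+ 2 * v.
    under eq_bigr => a _.
      rewrite (_ : _ * _ = P a + 2 * theta * (P a * Z a) +
         theta ^+ 2 * (P a * Z a ^+ 2)); last by rewrite /w; ring.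
      over.
    by rewrite !big_split /= -!mulr_sumr Z0 (proj2 fpsP) mulr0 addr0.
  have -> : u ^+ 2 * v = m%:R * (theta ^+ 2 * v) by rewrite -rm -tr; ring.
  rewrite expRM_natl lerXn2r ?nnegrE ?expR_ge0 ?expR_ge1Dx //.
  by rewrite addr_ge0 // mulr_ge0 ?sqr_ge0 // ltW.
move: near B0 W2; rewrite /prob expectation_tilt.
set B := expR _; set p := (X in 1 / (4 * B) <= X) => near B0 W2.
(* [1_A W <= B 1_A + W^2 / (4 B)] in place of Cauchy-Schwarz *)
have : 1 / 2 <= B * p + 1 / (4 * B) * B.
  apply: le_trans near _.
  apply: (@le_trans _ _ (B * p + 1 / (4 * B) *
      expectation P m (fun s => (\prod_(a <- s) w a) ^+ 2))); last first.
    by rewrite lerD2l ler_wpM2l // divr_ge0 // mulr_ge0 // ltW.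
  rewrite -!expectationZ -expectationD; apply: expectation_le => // s _.
  set W := \prod_(a <- s) w a; case: (K * r <= _); rewrite /= ?mulr1n ?mulr0n; last first.
    by rewrite mul0r mulr0 add0r mulr_ge0 ?sqr_ge0 // divr_ge0 // mulr_ge0 // ltW.
  rewrite mul1r mulr1 -subr_ge0.
  rewrite (_ : _ - W = (2 * B - W) ^+ 2 / (4 * B)); last by field; rewrite gt_eqF.
  by rewrite divr_ge0 ?sqr_ge0 // mulr_ge0 // ltW.
rewrite (_ : 1 / (4 * B) * B = 1 / 4); last by field; rewrite gt_eqF.
move=> h; rewrite ler_pdivrMr ?mulr_gt0 //; nra.
Qed.

(** It suffices that the first half exceeds [(K + 2 (1 + v)) sqrt m] and the second stays below
    [2 (1 + v) sqrt m]. These events are independent, and the second has probability at least 1/2 by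
    Chebyshev's inequality. *)
Lemma difference_anticoncentration Z (K : R) : \sum_a P a * Z a = 0 ->
  0 < \sum_a P a * Z a ^+ 2 ->
  exists2 c : R, 0 < c & exists m0 : nat, forall m, (m0 <= m)%N ->
    c <= prob P (m + m) (fun s => K * Num.sqrt m%:R <=
      \sum_(a <- take m s) Z a - \sum_(a <- drop m s) Z a).
Proof.
move=> Z0 v0; set v := \sum_a P a * Z a ^+ 2 in v0.
have [c c0 [m0 m0P]] := sum_anticoncentration (K + 2 * (1 + v)) Z0 v0.
exists (c * (1 / 2)); first lra.
exists m0.+1 => m m0m; set r : R := Num.sqrt m%:R.
have r0 : 0 < r by rewrite sqrtr_gt0 ltr0n; apply: leq_trans m0m.
have rm : r ^+ 2 = m%:R by rewrite sqr_sqrtr.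
have yr : 0 < 2 * (1 + v) * r by rewrite mulr_gt0 //; lra.
have far := chebyshev_sum fpsP m Z0 yr.
have near : 1 / 2 <= prob P m (fun s => \sum_(a <- s) Z a <= 2 * (1 + v) * r).
  apply: (@le_trans _ _ (prob P m (fun s =>
      ~~ (2 * (1 + v) * r <= `|\sum_(a <- s) Z a|)))).
    rewrite probC //.
    suff : m%:R * v / (2 * (1 + v) * r) ^+ 2 <= 1 / 2 by move: far; rewrite -/v; lra.
    rewrite ler_pdivrMr ?exprn_gt0 //.
    rewrite (_ : (2 * (1 + v) * r) ^+ 2 = m%:R * (4 * (1 + v) ^+ 2)); last first.
      by rewrite -rm; ring.
    rewrite mulrCA ler_wpM2l //; nra.
  apply: prob_le => s _; rewrite -ltNge => h; apply: ltW.
  exact: le_lt_trans (ler_norm _) h.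
apply: (@le_trans _ _ (prob P m (fun s => (K + 2 * (1 + v)) * r <= \sum_(a <- s) Z a)
   * prob P m (fun s => \sum_(a <- s) Z a <= 2 * (1 + v) * r))).
  apply: ler_pM => //; try lra; exact: m0P (ltnW m0m).
rewrite -(@prob_cat m m _ _ (fun s =>
   ((K + 2 * (1 + v)) * r <= \sum_(a <- take m s) Z a) &&
   (\sum_(a <- drop m s) Z a <= 2 * (1 + v) * r))) => [|s t sm tm].
  by apply: prob_le => s _ /andP[h1 h2]; lra.
by rewrite take_size_cat // drop_size_cat.
Qed.

End anticoncentration.

(** * Measure of open sets *)

Section bernoulli_bounds.
Local Open Scope classical_set_scope.
Local Open Scope ring_scope.
Variables (R : realType) (Omega : alphabetType) (P : Omega -> R).
Variable lam : probability (infinite_sequence Omega) R.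
Hypothesis fpsP : finite_probability_space P.
Hypothesis lamP : bernoulli_measure P lam.
Implicit Types (S : pred (seq Omega)).

Lemma measurable_prefix_set (A : set (seq Omega)) :
  measurable (prefix_set A : set (infinite_sequence Omega)).
Proof. by apply: sub_sigma_algebra; exists A. Qed.

Lemma le_prefix_set (A B : set (seq Omega)) :
  prefix_set A `<=` prefix_set B -> (lam (prefix_set A) <= lam (prefix_set B))%E.
Proof.
by move=> AB; apply: le_measure => //; rewrite inE; exact: measurable_prefix_set.
Qed.

Lemma prefix_set0 : prefix_set (set0 : set (seq Omega)) = set0.
Proof. by apply/seteqP; split=> // alpha [n]. Qed.

Lemma prefix_setU (A B : set (seq Omega)) :
  prefix_set (A `|` B) = prefix_set A `|` prefix_set B.
Proof.
apply/seteqP; split=> alpha; first by case=> n [?|?]; [left|right]; exists n.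
by case=> -[n ?]; exists n; [left|right].
Qed.

Lemma lam_prefix_sum (r : seq Omega) (A : Omega -> set (seq Omega)) :
  (lam (prefix_set [set s | exists2 a, a \in r & A a s]) <=
   \sum_(a <- r) lam (prefix_set (A a)))%E.
Proof.
elim: r => [|a r IH].
  rewrite big_nil (_ : [set _ | _] = set0) ?prefix_set0 ?measure0 //.
  by apply/seteqP; split=> // s [].
rewrite big_cons; apply: le_trans (leeD2l _ IH).
apply: le_trans (measureU2 _ (measurable_prefix_set _) (measurable_prefix_set _)).
rewrite -prefix_setU; apply: le_prefix_set => alpha [n [b]].
by rewrite inE => /orP[/eqP ->|br] Ab; exists n; [left|right; exists b].
Qed.

(** Induction on [k] by finite subadditivity: the next letter is moved into the fixed prefix, down
    to single cylinders. *)
Lemma lam_prefix_cat k S (s : seq Omega) :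
  (lam (prefix_set [set t | exists2 u, t = s ++ u & (size u == k) && S u]) <=
   (\prod_(a <- s) P a * prob P k S)%:E)%E.
Proof.
elim: k S s => [|k IH] S s.
  have [Ss|Ss] := boolP (S [::]).
    rewrite /prob /= Ss mulr1 -lamP; apply: le_prefix_set => alpha [n [u ns]].
    by case/andP=> /nilP u0 _; exists n; rewrite /= ns u0 cats0.
  rewrite /prob /= (negbTE Ss) mulr0 (_ : [set _ | _] = set0) ?prefix_set0 ?measure0 //.
  by apply/seteqP; split=> // t [u _ /andP[/nilP ->]]; apply/negP.
apply: (@le_trans _ _ (\sum_(a <- enum Omega) lam (prefix_set [set t |
    exists2 u, t = rcons s a ++ u & (size u == k) && S (a :: u)]))%E).
  apply: le_trans (lam_prefix_sum _ _); apply: le_prefix_set => alpha [n [[|a u] nu]] //=.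
  rewrite eqSS => uk; exists n; exists a; first by rewrite mem_enum.
  by exists u => //; rewrite nu cat_rcons.
rewrite /prob /= mulr_sumr -sumEFin big_enum; apply: lee_sum => a _.
apply: le_trans (IH (fun u => S (a :: u)) _) _.
by rewrite lee_fin -cats1 big_cat big_seq1 /= -mulrA.
Qed.

Lemma lam_prefix_size k S :
  (lam (prefix_set [set t | (size t == k) && S t]) <= (prob P k S)%:E)%E.
Proof.
have := lam_prefix_cat k S [::]; rewrite big_nil mul1r; apply: le_trans.
by apply: le_prefix_set => alpha [n nS]; exists n; exists (mkseq alpha n).
Qed.

(** Countable subadditivity over the word length; the weights [1 / (k + 1) - 1 / (k + 2)] telescope
    to partial sums of at most 1. *)
Lemma lam_prefix_series S (e : R) :
  (forall k, prob P k S <= e * (k.+1%:R^-1 - k.+2%:R^-1)) ->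
  (lam (prefix_set [set t | S t]) <= e%:E)%E.
Proof.
move=> Se.
have e0 : 0 <= e.
  have := le_trans (prob_ge0 fpsP 0 S) (Se 0%N).
  by rewrite pmulr_lge0 // subr_gt0 ltf_pV2 ?posrE // ltr_nat.
have u0 k : 0 <= e * (k.+1%:R^-1 - k.+2%:R^-1).
  exact: le_trans (prob_ge0 fpsP k S) (Se k).
apply: le_trans (measure_sigma_subadditive lam (F := fun k =>
  prefix_set [set t | (size t == k) && S t]) _ _ _) _.
- by move=> k; exact: measurable_prefix_set.
- exact: measurable_prefix_set.
- by move=> alpha [n nS]; exists n => //; exists n; rewrite /= size_mkseq eqxx.
apply: (@le_trans _ _ (\big[+%E/0%R]_(0 <= k <oo)
    (e * (k.+1%:R^-1 - k.+2%:R^-1))%:E)%E).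
  apply: lee_nneseries => // k _; apply: le_trans (lam_prefix_size _ _) _.
  by rewrite lee_fin.
apply: lime_le; first by apply: is_cvg_nneseries => n _ _; rewrite lee_fin.
apply: nearW => n; rewrite sumEFin lee_fin -mulr_sumr ler_piMr //.
rewrite (eq_bigr (fun k : nat => - (k.+2%:R^-1) - - (k.+1%:R^-1))); last first.
  by move=> k _; rewrite opprK addrC.
rewrite (telescope_sumr (fun k : nat => - (k.+1%:R^-1) : R)) //.
by rewrite opprK invr1 gerDr oppr_le0 invr_ge0.
Qed.

End bernoulli_bounds.

(** * Frequencies of letters *)

Section letter_counts.
Local Open Scope nat_scope.
Variable Omega : alphabetType.

(* [code_pair] stores the test index at position 0, hence the shift. *)
Definition code_count (a : Omega) (s : seq nat) (m l : nat) : nat :=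
  \sum_(0 <= i < l) (nth 0 s (m + i).+1 == enum_rank a).

Lemma code_countE (a : Omega) n (s : seq Omega) m l : m + l <= size s ->
  code_count a (code_pair (n, s)) m l = count_mem a (take l (drop m s)).
Proof.
move=> mls; have sz : size (take l (drop m s)) = l.
  by rewrite size_takel // size_drop leq_subRL ?(leq_trans _ mls) ?leq_addr.
rewrite -sum1_count big_mkcond /= (big_nth point) sz; apply: eq_big_nat => i /andP[_ il].
rewrite nth_take // nth_drop /= (nth_map point); last first.
  by apply: leq_trans mls; rewrite ltn_add2l.
rewrite (_ : (_ == _ :> nat) = (nth point s (m + i) == a)); first by case: eqP.
by rewrite (inj_eq (@ord_inj _)) (inj_eq enum_rank_inj).
Qed.

Lemma recursive_code_count (a : Omega) n (s m l : n.-tuple nat -> nat) :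
  recursive s -> recursive m -> recursive l ->
  recursive (fun x => code_count a (CodeSeq.decode (s x)) (m x) (l x)).
Proof. by move=> rs rm rl; rewrite /code_count; recursive_tac. Qed.

(** Subtraction is truncated, so one summand is zero. *)
Definition nat_dist (x y : nat) : nat := (x - y) + (y - x).

Lemma recursive_nat_dist n (f g : n.-tuple nat -> nat) :
  recursive f -> recursive g -> recursive (fun x => nat_dist (f x) (g x)).
Proof. by move=> rf rg; rewrite /nat_dist; recursive_tac. Qed.

End letter_counts.

Section frequency_law.
Local Open Scope classical_set_scope.
Local Open Scope ring_scope.
Variables (R : realType) (Omega : alphabetType) (P : Omega -> R).
Variable lam : probability (infinite_sequence Omega) R.
Hypothesis fpsP : finite_probability_space P.
Hypothesis lamP : bernoulli_measure P lam.

Lemma natr_nat_dist (x y : nat) :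
  (nat_dist x y)%:R = `|x%:R - y%:R| :> R.
Proof.
rewrite /nat_dist; case/orP: (leq_total x y) => xy.
  have -> : (x - y = 0)%N by apply/eqP.
  by rewrite add0n natrB // distrC ger0_norm // subr_ge0 ler_nat.
have -> : (y - x = 0)%N by apply/eqP.
by rewrite addn0 natrB // ger0_norm // subr_ge0 ler_nat.
Qed.

Lemma sum_centered_indicator (a : Omega) (s : seq Omega) :
  \sum_(b <- s) ((b == a)%:R - P a) = (count_mem a s)%:R - (size s)%:R * P a.
Proof.
rewrite sumrB big_const_seq count_predT iter_addr_0 mulr_natl; congr (_ - _).
by rewrite -sum1_count natr_sum [RHS]big_mkcond /=; apply: eq_bigr => b _; case: eqP.
Qed.

Lemma fps_le1 a : P a <= 1.
Proof.
by rewrite -(proj2 fpsP) (bigD1 a) //= lerDl sumr_ge0 // => b _; exact: (proj1 fpsP).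
Qed.

(** Chernoff's bound at [theta = 2 ^- j]: the quadratic term [2 k theta^2] is at most 8 since
    [k < 4 ^ j.+1], and [0 < j] ensures [theta <= 1 / 2]. *)
Lemma count_deviation_prob (a : Omega) k j (x : R) :
  (0 < j)%N -> (k < 4 ^ j.+1)%N ->
  prob P k (fun s => 2 ^+ j * x <= `|(count_mem a s)%:R - k%:R * P a|) <=
  2 * expR (8 - x).
Proof.
move=> j0 kj.
have p2 : 0 < 2 ^+ j :> R by rewrite exprn_gt0.
have Z0 : \sum_b P b * ((b == a)%:R - P a) = 0.
  under eq_bigr do rewrite mulrBr.
  rewrite sumrB -mulr_suml (proj2 fpsP) mul1r (bigD1 a) //= eqxx mulr1.
  by rewrite big1 ?addr0 ?subrr // => b /negbTE ->; rewrite mulr0.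
have Z1 b : `|(b == a)%:R - P a| <= 1.
  have := fps_le1 a; have := proj1 fpsP a.
  by rewrite ler_norml; case: (b == a) => /=; rewrite ?mulr1n ?mulr0n; lra.
have t2 : 0 <= ((2 ^+ j)^-1 : R) <= 1 / 2.
  rewrite invr_ge0 ltW //= div1r lef_pV2 ?posrE // -[leLHS]expr1.
  by rewrite ler_eXn2l // ltr1n.
apply: le_trans (le_trans _ (chernoff_abs_sum fpsP k (2 ^+ j * x) Z0 Z1 t2)) _.
  by apply: prob_le => // s sk; rewrite sum_centered_indicator sk.
rewrite ler_wpM2l // ler_expR mulKf ?gt_eqF // lerD2r.
rewrite exprVn ler_pdivrMr ?exprn_gt0 // -exprM muln2 -addnn exprD.
have : k%:R <= 4 * (2 ^+ j * 2 ^+ j) :> R.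
  rewrite -exprMn -natrM (_ : 2 * 2 = 4)%N // -exprS -natrX ler_nat; exact: ltnW.
by lra.
Qed.

(** Everything is compared with powers of 2: [(k + 1) (k + 2) <= 2 ^ (4 j + 5)], and the exponents
    reduce to [n + 4 j + 39 <= j ^ 2], which [n + 10 <= j] guarantees. *)
Lemma expR_gap n j k : (n + 10 <= j)%N -> (k < 4 ^ j.+1)%N ->
  2 * expR (16 - (j ^ 2)%:R) <= (2 ^+ n.+1)^-1 * (k.+1%:R^-1 - k.+2%:R^-1) :> R.
Proof.
move=> nj kj.
have e16 : expR 16 <= 2 ^+ 32 :> R.
  have -> : 16 = 32%:R * (1 / 2) :> R by field.
  rewrite expRM_natl lerXn2r ?nnegrE ?expR_ge0 //.
  by apply: le_trans (expR_quadratic_bound _) _; lra.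
have ej : 2 ^+ (j ^ 2) <= expR (j ^ 2)%:R :> R.
  rewrite -[(j ^ 2)%:R]mulr1 expRM_natl lerXn2r ?nnegrE ?expR_ge0 //.
  by apply: le_trans (expR_ge1Dx _); lra.
have -> : k.+1%:R^-1 - k.+2%:R^-1 = (k.+1 * k.+2)%:R^-1 :> R.
  have : 0 < k.+1%:R :> R by rewrite ltr0n.
  rewrite natrM -[k.+2%:R]natr1; move: (k.+1%:R : R) => x x0.
  by field; rewrite !gt_eqF // addr_gt0.
rewrite expRB -invfM mulrA ler_pdivrMr ?expR_gt0 // [leRHS]mulrC ler_pdivlMr ?mulr_gt0
  ?exprn_gt0 ?ltr0n //.
apply: (le_trans _ ej).
apply: (@le_trans _ _ (2 * 2 ^+ 32 * (2 ^+ n.+1 * (k.+1 * k.+2)%:R))).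
  apply: ler_wpM2r; first by rewrite mulr_ge0 ?exprn_ge0.
  by rewrite ler_wpM2l.
have -> : 2 * 2 ^+ 32 * (2 ^+ n.+1 * (k.+1 * k.+2)%:R) =
   (2 ^ (33 + n.+1) * (k.+1 * k.+2))%:R :> R.
  by rewrite [RHS]natrM natrX exprD [2 ^+ 33]exprS; ring.
rewrite -natrX ler_nat.
have k1 : (k.+1 <= 2 ^ (2 * j).+2)%N.
  by rewrite (_ : (2 * j).+2 = 2 * j.+1)%N ?expnM // mulnS.
have k2 : (k.+2 <= 2 ^ (2 * j).+3)%N.
  by rewrite expnS; move: k1; have := expn_gt0 2 (2 * j).+2; lia.
apply: (leq_trans (leq_mul (leqnn _) (leq_mul k1 k2))).
by rewrite -!expnD leq_exp2l //; nia.
Qed.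

Section letter.
Variables (a : Omega) (A B : nat -> nat).
Hypotheses (rA : total_recursive A) (rB : total_recursive B).
Hypothesis AB : forall k, `|P a - ((A k)%:R - (B k)%:R) / 2 ^+ k| <= 2 / 2 ^+ k.

(** The deviation of the count of [a], scaled by [2 ^ j], with the negative terms moved across to
    stay in the natural numbers. The predecessor of the size discounts the test index at position
    0. *)
Definition frequency_deviates (s : seq nat) : bool :=
  let k := (size s).-1 in let j := trunc_log 4 k in
  (nth 0 s 0 + 10 <= j)%N &&
  (2 ^ j * 2 ^ j * j ^ 2 <=
     nat_dist (code_count a s 0 k * 2 ^ j + k * B j) (k * A j))%N.

Lemma recursive_frequency_deviates : recursive_pred_seq frequency_deviates.
Proof.
rewrite /recursive_pred_seq /frequency_deviates; recursive_tac => //.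
apply: recursive_nat_dist; recursive_tac => //.
by apply: recursive_code_count; recursive_tac.
Qed.

(** Approximating [P a] to within [2 / 2 ^+ j] costs [2 k] after scaling by [2 ^+ j], and
    [k < 4 ^ j.+1]. *)
Lemma dyadic_count_dist (s : seq Omega) k j :
  (k < 4 ^ j.+1)%N ->
  `| `|(count_mem a s)%:R - k%:R * P a| * 2 ^+ j -
     (nat_dist (count_mem a s * 2 ^ j + k * B j) (k * A j))%:R| <=
  8 * (2 ^+ j * 2 ^+ j) :> R.
Proof.
move=> kj4; have p2 : 0 < 2 ^+ j :> R by rewrite exprn_gt0.
have kj : k%:R <= 4 * (2 ^+ j * 2 ^+ j) :> R.
  rewrite -exprMn -natrM (_ : 2 * 2 = 4)%N // -exprS -natrX ler_nat; exact: ltnW.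
rewrite natr_nat_dist natrD !natrM natrX.
rewrite -{1}(gtr0_norm p2) -normrM; apply: le_trans (ler_dist_dist _ _) _.
have -> : ((count_mem a s)%:R - k%:R * P a) * 2 ^+ j -
   ((count_mem a s)%:R * 2 ^+ j + k%:R * (B j)%:R - k%:R * (A j)%:R) =
   - (k%:R * (2 ^+ j * (P a - ((A j)%:R - (B j)%:R) / 2 ^+ j))) :> R.
  by field; rewrite gt_eqF.
rewrite normrN !normrM (gtr0_norm p2) normr_nat.
have h : 2 ^+ j * `|P a - ((A j)%:R - (B j)%:R) / 2 ^+ j| <= 2.
  by rewrite mulrC -ler_pdivlMr.
apply: (@le_trans _ _ (k%:R * 2)); first by rewrite ler_wpM2l.
by lra.
Qed.

Lemma frequency_test : martin_lof_test lam
  [set u : nat * seq Omega | (0 < u.1)%N && frequency_deviates (code_pair u)].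
Proof.
split; first by move=> u /andP[].
  exact: (recursively_enumerable_test Omega recursive_frequency_deviates).
(* The series bound is not strict, so half of the allowed measure is aimed at. *)
move=> n n0; apply: (@le_lt_trans _ _ ((2 ^+ n.+1)^-1)%:E); last first.
  rewrite lte_fin ltf_pV2 ?posrE ?exprn_gt0 // exprS.
  by rewrite ltr_pMl ?exprn_gt0 // ltr1n.
rewrite (_ : test_section _ n = [set t | frequency_deviates (code_pair (n, t))]).
  2: by apply/seteqP; split => s; rewrite /test_section /= n0.
apply: (lam_prefix_series fpsP lamP (S := fun t => frequency_deviates (code_pair (n, t)))).
move=> k; pose j := trunc_log 4 k.
have kj : (k < 4 ^ j.+1)%N by exact: trunc_log_ltn.
have [nj|jn] := leqP (n + 10) j; last first.
  rewrite (_ : prob _ _ _ = 0); last first.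
    rewrite -(expectation_cst fpsP k 0); apply: eq_expectation => s sk.
    by rewrite /frequency_deviates /= size_map sk leqNgt jn.
  by rewrite mulr_ge0 ?invr_ge0 ?exprn_ge0 // subr_ge0 lef_pV2 ?posrE // ler_nat.
apply: le_trans (expR_gap nj kj).
(* Of the 16, one 8 is the quadratic term of Chernoff's bound; the other is the dyadic error, which
   lowers the threshold from [j ^ 2] to [j ^ 2 - 8]. *)
rewrite (_ : 16 - _ = 8 - ((j ^ 2)%:R - 8)); last by ring.
apply: le_trans (count_deviation_prob a ((j ^ 2)%:R - 8) _ kj); last by lia.
apply: prob_le => // s sk /andP[_]; rewrite /= size_map sk -/j.
rewrite code_countE ?sk // drop0 -sk take_size sk -(ler_nat R).
have := dyadic_count_dist s kj; rewrite ler_norml => /andP[h _].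
rewrite !natrM !natrX => d.
have p2 : 0 < 2 ^+ j :> R by rewrite exprn_gt0.
by rewrite -(ler_pM2r p2); lra.
Qed.

End letter.

(** Some section [n] of the test contains no prefix of [alpha], so the coded comparison fails at
    every prefix with [n + 10 <= j]; the 8 absorbs the dyadic error. *)
Lemma random_frequency alpha (a : Omega) :
  computable_real (P a) -> martin_lof_random lam alpha ->
  exists j0 : nat, forall k, let j := trunc_log 4 k in (j0 <= j)%N ->
    `|(count_mem a (mkseq alpha k))%:R - k%:R * P a| <= 2 ^+ j * (j%:R ^+ 2 + 8).
Proof.
move=> /computable_real_dyadic[A [B [rA rB AB]]] alphaR.
have [n n0 nalpha] := alphaR _ (frequency_test rA rB AB).
exists (n + 10)%N => k j jn.
have := dyadic_count_dist AB (mkseq alpha k) (trunc_log_ltn k (isT : 1 < 4)%N).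
rewrite -/j.
set N := count_mem a _; set D := nat_dist _ _; rewrite ler_norml => /andP[_ h].
have : ~~ (2 ^ j * 2 ^ j * j ^ 2 <= D)%N.
  apply/negP => le; apply: nalpha; exists k.
  rewrite /test_section /= n0 /frequency_deviates /= size_map size_mkseq -/j jn.
  by rewrite code_countE ?size_mkseq // drop0 -{1}(size_mkseq alpha k) take_size.
rewrite -ltnNge -(ltr_nat R) !natrM !natrX => d.
have p2 : 0 < 2 ^+ j :> R by rewrite exprn_gt0.
by rewrite -(ler_pM2r p2); lra.
Qed.

End frequency_law.

(** * Fluctuations of the sums *)

Section fluctuations.
Local Open Scope classical_set_scope.
Local Open Scope ring_scope.
Variables (R : realType) (Omega : alphabetType) (P X : Omega -> R).
Variable lam : probability (infinite_sequence Omega) R.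
Hypothesis fpsP : finite_probability_space P.
Hypothesis lamP : bernoulli_measure P lam.
Hypothesis varX : 0 < var P X.

(** Used with [i = 1] and [i = 25]: two adjacent blocks covering the positions from [64 ^ j] up to
    [49 * 64 ^ j], which is below [64 ^ j.+1]. Different [j] therefore use disjoint positions. *)
Definition block (j i : nat) (s : seq Omega) : seq Omega :=
  take (24 * 64 ^ j) (drop (i * 64 ^ j) s).

Definition block_gap (j : nat) (s : seq Omega) : R :=
  `|\sum_(b <- block j 1 s) X b - \sum_(b <- block j 25 s) X b|.

Lemma size_block j i s :
  ((i + 24) * 64 ^ j <= size s)%N -> size (block j i s) = (24 * 64 ^ j)%N.
Proof.
move=> le; rewrite size_takel // size_drop leq_subRL; first by rewrite -mulnDl.
by apply: leq_trans le; rewrite leq_mul2r leq_addr orbT.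
Qed.

Lemma block_cat j i s u :
  ((i + 24) * 64 ^ j <= size s)%N -> block j i (s ++ u) = block j i s.
Proof.
rewrite mulnDl => le.
rewrite /block drop_cat ifT; last by have := expn_gt0 64 j; lia.
by rewrite takel_cat // size_drop; lia.
Qed.

Lemma block_gap_cat j s u :
  (64 ^ j.+1 <= size s)%N -> block_gap j (s ++ u) = block_gap j s.
Proof.
rewrite expnS => le; rewrite /block_gap !block_cat //;
  by apply: leq_trans le; rewrite leq_mul2r orbT.
Qed.

Lemma block_gap_last j s u v :
  size s = (64 ^ j)%N -> size u = (24 * 64 ^ j + 24 * 64 ^ j)%N ->
  block_gap j (s ++ (u ++ v)) =
  `|\sum_(b <- take (24 * 64 ^ j) u) X b - \sum_(b <- drop (24 * 64 ^ j) u) X b|.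
Proof.
move=> ss su; have e0 := expn_gt0 64 j.
rewrite /block_gap /block mul1n -ss drop_size_cat // ss.
rewrite drop_cat ss ifN; last by rewrite -leqNgt; lia.
rewrite (_ : 25 * 64 ^ j - 64 ^ j = 24 * 64 ^ j)%N; last by lia.
rewrite takel_cat; last by rewrite su; lia.
rewrite drop_cat su ifT; last by lia.
by rewrite take_size_cat // size_drop su; lia.
Qed.

Lemma mean_centered : \sum_a P a * (X a - mean P X) = 0.
Proof.
under eq_bigr do rewrite mulrBr.
rewrite sumrB -mulr_suml (proj2 fpsP) mul1r /mean.
by apply/eqP; rewrite subr_eq0; apply/eqP; apply: eq_bigr => a _; rewrite mulrC.
Qed.

Lemma block_gap_prob : exists2 c : R, 0 < c & exists j0 : nat, forall j, (j0 <= j)%N ->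
  prob P (24 * 64 ^ j + 24 * 64 ^ j) (fun s =>
    `|\sum_(b <- take (24 * 64 ^ j) s) X b - \sum_(b <- drop (24 * 64 ^ j) s) X b|
      <= 210 * 8 ^+ j) <= 1 - c.
Proof.
have v0 : 0 < \sum_a P a * (X a - mean P X) ^+ 2.
  by move: varX; rewrite /var; under eq_bigr do rewrite mulrC.
(* Taking 211 instead of 210 makes the comparison with [210 * 8 ^+ j] strict, since
   [8 ^+ j <= sqrt m] for the block length [m]. The means cancel because the blocks have equal
   length. *)
have [c c0 [m0 m0P]] := difference_anticoncentration fpsP 211 mean_centered v0.
exists c => //; exists m0 => j mj; pose m := (24 * 64 ^ j)%N.
have jm : (j <= m)%N.
  by apply: (leq_trans (ltnW (ltn_expl j (isT : 1 < 64)%N))); rewrite leq_pmull.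
have sqm : 8 ^+ j <= Num.sqrt m%:R :> R.
  rewrite -(@ler_pXn2r _ 2) ?nnegrE ?sqrtr_ge0 ?exprn_ge0 // sqr_sqrtr ?ler0n //.
  rewrite -exprM mulnC exprM -natrX -natrX ler_nat (_ : 8 ^ 2 = 64)%N //.
  by rewrite leq_pmull.
have e8 : 0 < 8 ^+ j :> R by rewrite exprn_gt0.
have := m0P m (leq_trans mj jm); rewrite -/m => cp.
rewrite lerBrDl -lerBrDr -probC //; apply: le_trans cp _.
apply: prob_le => // s sm; rewrite !sumrB !big_const_seq !count_predT.
rewrite size_takel ?size_drop sm ?addnK ?leq_addr // opprB addrA subrK => h.
rewrite -ltNge; apply: lt_le_trans (ler_norm _); apply: lt_le_trans h.
apply: (@lt_le_trans _ _ (211 * 8 ^+ j)); first by rewrite ltr_pM2r // ltr_nat.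
by rewrite ler_wpM2l.
Qed.

Lemma small_gaps_prob : exists2 c : R, 0 < c <= 1 & exists j0 : nat, forall j1 i,
  (j0 <= j1)%N ->
  prob P (64 ^ (j1 + i)) (fun s =>
    all (fun j => block_gap (j1 + j) s <= 210 * 8 ^+ (j1 + j)) (iota 0 i)) <=
  (1 - c) ^+ i.
Proof.
have [c c0 [j0 j0P]] := block_gap_prob.
have c1 : 0 <= 1 - c by apply: le_trans (j0P j0 (leqnn _)); exact: prob_ge0.
exists c; first by rewrite c0 /=; lra.
exists j0 => j1 i j01; elim: i => [|i IH]; first by rewrite expr0 prob_le1.
(* A word of length [64 ^ J.+1] is cut into [64 ^ J] letters deciding the earlier gaps,
   [48 * 64 ^ J] letters deciding gap [J], and [15 * 64 ^ J] unconstrained letters; independence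
   multiplies the bounds. *)
set J := (j1 + i)%N in IH *; rewrite addnS -/J expnS.
rewrite (_ : 64 * 64 ^ J = 64 ^ J + ((24 * 64 ^ J + 24 * 64 ^ J) + 15 * 64 ^ J))%N;
  last by lia.
pose T s := `|\sum_(b <- take (24 * 64 ^ J) s) X b -
   \sum_(b <- drop (24 * 64 ^ J) s) X b| <= 210 * 8 ^+ J.
pose T' s := T (take (24 * 64 ^ J + 24 * 64 ^ J) s).
rewrite (@prob_cat _ _ P _ _ (fun s =>
  all (fun j => block_gap (j1 + j) s <= 210 * 8 ^+ (j1 + j)) (iota 0 i)) T').
  rewrite exprSr; apply: ler_pM => //; try exact: prob_ge0.
  rewrite (@prob_cat _ _ P _ _ T predT) => [|s u ss su]; last first.
    by rewrite /T' -ss take_size_cat // andbT.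
  apply: le_trans (j0P J _); last by rewrite (leq_trans j01) // leq_addr.
  by rewrite ler_piMr ?prob_ge0 ?prob_le1.
move=> s t ss tt; rewrite -[i.+1]addn1 iotaD all_cat /= andbT add0n -/J; congr (_ && _).
  apply: eq_in_all => j; rewrite mem_iota add0n => /= ji.
  rewrite block_gap_cat // ss leq_exp2l //.
  by rewrite -addnS leq_add2l.
rewrite /T' /T -{1}(cat_take_drop (24 * 64 ^ J + 24 * 64 ^ J) t) block_gap_last //.
by rewrite size_takel // tt leq_addr.
Qed.

Lemma sum_count (F : Omega -> R) (s : seq Omega) :
  \sum_(b <- s) F b = \sum_a F a * (count_mem a s)%:R.
Proof.
elim: s => [|b s IH].
  by rewrite big_nil big1 // => a _; rewrite mulr0.
rewrite big_cons IH /=; under [RHS]eq_bigr do rewrite natrD mulrDr.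
rewrite big_split /=; congr (_ + _); rewrite (bigD1 b) //= eqxx mulr1.
by rewrite big1 ?addr0 // => a /negbTE; rewrite eq_sym => ->; rewrite mulr0.
Qed.

Section dyadic.
Variables (A B : Omega -> nat -> nat).
Hypotheses (rA : forall a, total_recursive (A a))
  (rB : forall a, total_recursive (B a)).
Hypothesis AB : forall a k, `|X a - ((A a k)%:R - (B a k)%:R) / 2 ^+ k| <= 2 / 2 ^+ k.

(** [block_gap] scaled by [8 ^ j], with [X] approximated at precision index [3 * j]. The product
    [(N 1 a - N 25 a) * (A a - B a)] is expanded and its positive and negative terms are collected
    separately. *)
Definition code_gap (j : nat) (s : seq nat) : nat :=
  let N i a := code_count a s (i * 64 ^ j) (24 * 64 ^ j) in
  nat_dist
    (\sum_(a <- enum Omega) (N 1 a * A a (3 * j) + N 25 a * B a (3 * j)))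
    (\sum_(a <- enum Omega) (N 25 a * A a (3 * j) + N 1 a * B a (3 * j))).

Lemma recursive_code_gap n (f g : n.-tuple nat -> nat) :
  recursive f -> recursive g ->
  recursive (fun x => code_gap (f x) (CodeSeq.decode (g x))).
Proof.
move=> rf rg; rewrite /code_gap; apply: recursive_nat_dist.
all: apply: recursive_big => a; have rAa := rA a; have rBa := rB a; recursive_tac.
all: by apply: recursive_code_count; recursive_tac.
Qed.

(** After scaling, each of the [48 * 64 ^ j] letters in the two blocks contributes an error of at
    most 2. *)
Lemma code_gapE j n s : (49 * 64 ^ j <= size s)%N ->
  `|block_gap j s * 8 ^+ j - (code_gap j (code_pair (n, s)))%:R| <=
  96 * (8 ^+ j * 8 ^+ j).
Proof.
move=> le; have e8 : 0 < 8 ^+ j :> R by rewrite exprn_gt0.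
have e28 : 2 ^+ (3 * j) = 8 ^+ j :> R.
  by rewrite exprM; congr (_ ^+ j); ring.
have le1 : ((1 + 24) * 64 ^ j <= size s)%N by lia.
have le25 : ((25 + 24) * 64 ^ j <= size s)%N by lia.
have s1 := size_block le1; have s25 := size_block le25.
move: le1 le25; rewrite !mulnDl => le1 le25.
pose N1 a : R := (count_mem a (block j 1 s))%:R.
pose N2 a : R := (count_mem a (block j 25 s))%:R.
have nN a : code_count a (code_pair (n, s)) (1 * 64 ^ j) (24 * 64 ^ j) =
    count_mem a (block j 1 s).
  exact: code_countE le1.
have nN' a : code_count a (code_pair (n, s)) (25 * 64 ^ j) (24 * 64 ^ j) =
    count_mem a (block j 25 s).
  exact: code_countE le25.
rewrite /code_gap; set U := (X in nat_dist X _); set V := (X in nat_dist _ X).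
have UV : U%:R - V%:R =
    \sum_a ((A a (3 * j))%:R - (B a (3 * j))%:R) * (N1 a - N2 a) :> R.
  rewrite /U /V !natr_sum -sumrB big_enum; apply: eq_bigr => a _.
  by rewrite nN nN' !natrD !natrM /N1 /N2; ring.
rewrite natr_nat_dist UV /block_gap (sum_count X (block j 1 s)) (sum_count X (block j 25 s))
  -sumrB -{1}(gtr0_norm e8) -normrM.
apply: le_trans (ler_dist_dist _ _) _.
rewrite mulr_suml -sumrB.
apply: (@le_trans _ _ (\sum_a 2 * (N1 a + N2 a))).
  apply: le_trans (ler_norm_sum _ _ _) _; apply: ler_sum => a _.
  rewrite (_ : _ - _ = (X a - ((A a (3 * j))%:R - (B a (3 * j))%:R) / 8 ^+ j) *
     8 ^+ j * (N1 a - N2 a)); last by rewrite /N1 /N2; field; rewrite gt_eqF.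
  rewrite !normrM; apply: ler_pM; rewrite ?mulr_ge0 //.
    by have := AB a (3 * j); rewrite e28 ler_pdivlMr // (gtr0_norm e8).
  by apply: le_trans (ler_normB _ _) _; rewrite !ger0_norm.
rewrite -mulr_sumr big_split /=.
have cnt (t : seq Omega) : \sum_a (count_mem a t)%:R = (size t)%:R :> R.
  have := sum_count (fun=> 1) t; rewrite big_const_seq count_predT iter_addr_0 => ->.
  by apply: eq_bigr => a _; rewrite mul1r.
rewrite !cnt s1 s25 -exprMn -natrM (_ : 8 * 8 = 64)%N // -natrX natrM.
lra.
Qed.

Variables (j1 r : nat).

(* [114 = 18 + 96], where 96 is the approximation error of [code_gapE]; the
   same error gives [210 = 114 + 96] in [small_gaps_prob]. *)
Definition gaps_small (s : seq nat) : bool :=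
  ((size s).-1 == 64 ^ (j1 + nth 0 s 0 * r))%N &&
  all (fun j => code_gap (j1 + j) s <= 114 * 8 ^ (j1 + j) * 8 ^ (j1 + j))%N
    (iota 0 (nth 0 s 0 * r)%N).

Lemma recursive_gaps_small : recursive_pred_seq gaps_small.
Proof.
rewrite /recursive_pred_seq /gaps_small; recursive_tac.
by apply: recursive_code_gap; recursive_tac.
Qed.

End dyadic.

(** The expression is the difference of the two block sums. If it stayed within [18 * 8 ^+ j] for
    all [j >= j0], then [alpha] would fail the test built from [gaps_small]. *)
Lemma random_fluctuation alpha :
  (forall a, computable_real (X a)) -> martin_lof_random lam alpha ->
  let S k := \sum_(i < k) X (alpha i) in
  forall j0 : nat, exists2 j, (j0 <= j)%N &
    18 * 8 ^+ j < `|2 * S (25 * 64 ^ j)%N - S (64 ^ j)%N - S (49 * 64 ^ j)%N|.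
Proof.
move=> Xc alphaR S j0.
have /choice[A] : forall a, exists A, exists B : nat -> nat,
    [/\ total_recursive A, total_recursive B &
     forall k, `|X a - ((A k)%:R - (B k)%:R) / 2 ^+ k| <= 2 / 2 ^+ k].
  by move=> a; exact: computable_real_dyadic (Xc a).
move=> /choice[B ABP].
have rA a : total_recursive (A a) by have [] := ABP a.
have rB a : total_recursive (B a) by have [] := ABP a.
have AB a k : `|X a - ((A a k)%:R - (B a k)%:R) / 2 ^+ k| <= 2 / 2 ^+ k.
  by have [] := ABP a.
have [c /andP[c0 c1] [j2 j2P]] := small_gaps_prob.
pose j1 := maxn j0 j2.
(* [r] gaps halve the measure: [(1 - c) ^+ r <= expR (- (r * c))], and
   [expR (r * c) >= 1 + r * c > 2]. *)
pose r := Num.bound (2 / c).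
have rc : (1 - c) ^+ r < 1 / 2.
  have rr : 2 < r%:R * c.
    by rewrite -ltr_pdivrMr //; apply: archi_boundP; rewrite divr_ge0 // ltW.
  apply: (@le_lt_trans _ _ (expR (- c) ^+ r)).
    by rewrite lerXn2r ?nnegrE ?expR_ge0 ?subr_ge0 // expR_ge1Dx.
  rewrite -expRM_natl mulrN expRN div1r ltf_pV2 ?posrE ?expR_gt0 //.
  by apply: lt_le_trans (expR_ge1Dx _); rewrite (lt_trans rr) // ltrDr.
apply: contrapT => noj.
have small j : (j0 <= j)%N ->
    `|2 * S (25 * 64 ^ j)%N - S (64 ^ j)%N - S (49 * 64 ^ j)%N| <= 18 * 8 ^+ j.
  by move=> jj; rewrite leNgt; apply/negP => lt; apply: noj; exists j.
have test : martin_lof_test lam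
    [set u : nat * seq Omega | (0 < u.1)%N && gaps_small A B j1 r (code_pair u)].
  split; first by move=> u /andP[].
    exact: (recursively_enumerable_test Omega (recursive_gaps_small rA rB j1 r)).
  move=> n n0.
  (* Coded gaps below 114 force real gaps below 210, to which the independence bound applies. *)
  apply: (@le_lt_trans _ _ (lam (prefix_set [set t |
    (size t == 64 ^ (j1 + n * r))%N && all (fun j => block_gap (j1 + j) t <=
       210 * 8 ^+ (j1 + j)) (iota 0 (n * r))]))).
    apply: le_prefix_set => alpha' [l]; rewrite /test_section /= n0 /=.
    set t := mkseq alpha' l; rewrite /gaps_small /= size_map => /andP[st /allP at'].
    exists l; rewrite /= -/t st /=; apply/allP => j jn; have := at' j jn.
    rewrite -(ler_nat R) !natrM !natrX => h.
    have e8 : 0 < 8 ^+ (j1 + j) :> R by rewrite exprn_gt0.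
    have le49 : (49 * 64 ^ (j1 + j) <= size t)%N.
      rewrite (eqP st); move: jn; rewrite mem_iota add0n => /= jn.
      apply: (@leq_trans (64 ^ (j1 + j).+1)); first by rewrite expnS leq_mul2r orbT.
      by rewrite leq_exp2l // -addnS leq_add2l.
    have := code_gapE AB n le49.
    rewrite ler_norml => /andP[_ h'].
    by rewrite -(ler_pM2r e8); lra.
  apply: le_lt_trans (lam_prefix_size lamP _ _) _.
  rewrite lte_fin; apply: le_lt_trans (j2P j1 _ _) _; first by rewrite leq_maxr.
  rewrite mulnC exprM -exprVn ltrXn2r ?lt0n_neq0 //; last by rewrite -div1r.
  by rewrite exprn_ge0 // subr_ge0.
(* The prefix of this length lies in section [n], contradicting the choice of [n]. *)
have [n n0] := alphaR _ test; apply; exists (64 ^ (j1 + n * r))%N.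
rewrite /test_section /= n0 /gaps_small /= size_map size_mkseq eqxx /=.
apply/allP => j; rewrite mem_iota add0n => /= jn.
set s := mkseq _ _; rewrite -(ler_nat R) !natrM !natrX.
have e8 : 0 < 8 ^+ (j1 + j) :> R by rewrite exprn_gt0.
have le49 : (49 * 64 ^ (j1 + j) <= 64 ^ (j1 + n * r))%N.
  apply: (@leq_trans (64 ^ (j1 + j).+1)); first by rewrite expnS leq_mul2r orbT.
  by rewrite leq_exp2l // -addnS leq_add2l.
have := code_gapE AB (j := j1 + j) n (s := s); rewrite size_mkseq => /(_ le49).
rewrite ler_norml => /andP[h _].
suff gap18 : block_gap (j1 + j) s <= 18 * 8 ^+ (j1 + j).
  by have := ler_wpM2r (ltW e8) gap18; lra.
apply: le_trans (small (j1 + j)%N _); last first.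
  by rewrite (leq_trans _ (leq_addr _ _)) // leq_maxl.
rewrite /block_gap.
have blk i : ((i + 24) * 64 ^ (j1 + j) <= 64 ^ (j1 + n * r))%N ->
  \sum_(b <- block (j1 + j) i s) X b =
  S ((i + 24) * 64 ^ (j1 + j))%N - S (i * 64 ^ (j1 + j))%N.
  move=> le; rewrite /block /s /mkseq -map_drop -map_take big_map.
  rewrite drop_iota take_iota add0n /S -!(big_mkord predT (fun i => X (alpha i))).
  rewrite (minn_idPl _); last by rewrite leq_subRL ?(leq_trans _ le) // ?mulnDl ?leq_addr.
  rewrite [X in _ = X - _](big_cat_nat _ (n := i * 64 ^ (j1 + j))) //=; last first.
    by rewrite leq_mul2r leq_addr orbT.
  by rewrite addrAC subrr add0r /index_iota mulnDl addKn.
rewrite !blk ?mul1n //; last first.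
  by apply: leq_trans le49; rewrite leq_mul2r orbT.
rewrite (_ : 1 + 24 = 25)%N // (_ : 25 + 24 = 49)%N //.
rewrite le_eqVlt; apply/orP; left; apply/eqP.
by congr `|_|; ring.
Qed.

End fluctuations.

(** * Growth comparison and the equivalence *)

Local Open Scope ring_scope.

(** From [n^t <= k] follows [k / n >= k^(1 - 1/t)], and [4^j <= k] makes this at least
    [2^j * 2^(j (1 - 2/t))], whose last factor outgrows any polynomial in [j]. *)
Lemma powR_dominates (R : realType) (t C : R) : 2 < t ->
  exists j1 : nat, forall j n k : nat,
  (j1 <= j)%N -> (0 < n)%N -> (4 ^ j <= k)%N -> (n%:R : R) `^ t <= k%:R ->
  C * (2 ^+ j * (j%:R ^+ 2 + 8)) * n%:R < k%:R.
Proof.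
move=> t2; have ln2 : 0 < ln 2 :> R by rewrite ln_gt0 // ltr1n.
(* Then [2^(j (1 - 2/t)) = expR (j y) ^+ 3 > (j y) ^+ 3], a cubic that beats
   [C' (j^2 + 8) <= 9 C' j^2] once [j > 9 C' / y^3] and [j >= 1]. *)
pose y : R := (1 - 2 / t) * ln 2 / 3.
have y0 : 0 < y.
  by rewrite divr_gt0 // mulr_gt0 // subr_gt0 ltr_pdivrMr ?mul1r //; lra.
pose C' : R := `|C|; have C0 : 0 <= C' by rewrite normr_ge0.
have [j1 j1P] : exists j1 : nat, 9 * C' / y ^+ 3 < j1%:R.
  exists (Num.bound (9 * C' / y ^+ 3)); apply: archi_boundP.
  by apply: divr_ge0; [exact: mulr_ge0 | rewrite exprn_ge0 // ltW].
exists j1.+1 => j n k j1j n0 jk ntk.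
have t0 : 0 < t by lra.
have n0' : 0 < n%:R :> R by rewrite ltr0n.
have k0 : 0 < k%:R :> R by rewrite ltr0n (leq_trans _ jk) // expn_gt0.
have lnk : 2 * j%:R * ln 2 <= ln k%:R :> R.
  have -> : 2 * j%:R * ln 2 = ln ((4 ^ j)%:R : R).
    rewrite (_ : 4 ^ j = 2 ^ (2 * j))%N; last by rewrite expnM.
    by rewrite natrX lnXn // -[RHS]mulr_natl natrM.
  by rewrite ler_ln ?posrE ?ler_nat // ltr0n expn_gt0.
have lnn : ln n%:R <= ln k%:R / t :> R.
  by rewrite ler_pdivlMr // mulrC -ln_powR ler_ln ?posrE ?powR_gt0.
have -> : k%:R = expR (ln k%:R - ln k%:R / t) * expR (ln k%:R / t) :> R.
  by rewrite -expRD subrK lnK ?posrE.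
have nk : n%:R <= expR (ln k%:R / t) :> R by rewrite -[leLHS]lnK ?posrE // ler_expR.
have p0 : 0 <= 2 ^+ j * (j%:R ^+ 2 + 8) :> R.
  by apply: mulr_ge0; [exact: exprn_ge0 | rewrite addr_ge0 ?sqr_ge0].
apply: (@le_lt_trans _ _ (C' * (2 ^+ j * (j%:R ^+ 2 + 8)) * expR (ln k%:R / t))).
  apply: (@le_trans _ _ (C' * (2 ^+ j * (j%:R ^+ 2 + 8)) * n%:R)).
    by apply: ler_wpM2r => //; apply: ler_wpM2r => //; exact: ler_norm.
  by apply: ler_wpM2l => //; exact: mulr_ge0.
rewrite ltr_pM2r ?expR_gt0 //.
have -> : ln k%:R - ln k%:R / t = ln k%:R * (1 - t^-1) :> R by rewrite mulrBr mulr1.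
apply: (@lt_le_trans _ _ (expR (j%:R * ln 2 + j%:R * (y * 3)))); last first.
  rewrite ler_expR; apply: (@le_trans _ _ (2 * j%:R * ln 2 * (1 - t^-1))).
    by rewrite /y divfK //; lra.
  by rewrite ler_wpM2r // subr_ge0 invf_le1 //; lra.
rewrite expRD expRM_natl lnK ?posrE // mulrCA ltr_pM2l ?exprn_gt0 //.
have j0 : 1 <= j%:R :> R by rewrite ler1n (leq_trans _ j1j).
apply: (@le_lt_trans _ _ (j%:R ^+ 3 * y ^+ 3)).
  have Cj : 9 * C' <= j%:R * y ^+ 3.
    rewrite -ler_pdivrMr ?exprn_gt0 // (le_trans (ltW j1P)) // ler_nat.
    exact: ltnW.
  apply: (@le_trans _ _ (9 * C' * j%:R ^+ 2)); last first.
    by rewrite [j%:R ^+ 3]exprS [leRHS]mulrAC ler_wpM2r // sqr_ge0.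
  have j2 : 1 <= j%:R ^+ 2 :> R by rewrite exprn_ege1.
  nra.
rewrite (_ : j%:R * (y * 3) = 3%:R * (j%:R * y)); last by ring.
rewrite -exprMn expRM_natl.
have jy0 : 0 <= j%:R * y by apply: mulr_ge0 => //; exact: ltW.
rewrite ltrXn2r //.
by apply: lt_le_trans (expR_ge1Dx _); rewrite ltrDr.
Qed.

Theorem theorem21 (R : realType) (Omega : alphabetType) (P X : Omega -> R)
    (lam : probability (infinite_sequence Omega) R) (alpha : nat -> Omega) :
  finite_probability_space P ->
  (forall a, computable_real (P a)) ->
  (forall a, computable_real (X a)) ->
  0 < var P X ->
  bernoulli_measure P lam ->
  martin_lof_random lam alpha ->
  forall t : R, 0 < t ->
    (exists2 M : nat, (0 < M)%N &
      forall n k : nat, (M <= n)%N -> (0 < k)%N ->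
        (n%:R : R) `^ t <= k%:R ->
        `|(k%:R)^-1 * (\sum_(i < k) X (alpha i)) - mean P X| < (n%:R)^-1)
    <-> 2 < t.
Proof.
move=> fpsP Pc Xc varX lamP alphaR t t0.
pose S k : R := \sum_(i < k) X (alpha i).
have devE (n k : nat) : (0 < n)%N -> (0 < k)%N ->
    (`|(k%:R)^-1 * S k - mean P X| < (n%:R)^-1) =
    (`|S k - k%:R * mean P X| * n%:R < k%:R).
  move=> n0 k0; have k0' : 0 < k%:R :> R by rewrite ltr0n.
  have -> : (k%:R)^-1 * S k - mean P X = (k%:R)^-1 * (S k - k%:R * mean P X).
    by rewrite mulrBr mulKf // gt_eqF.
  rewrite normrM gtr0_norm ?invr_gt0 // ltr_pdivrMl //.
  by rewrite ltr_pdivlMr // ltr0n.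
split=> [[M M0 MP]|t2].
  rewrite ltNge; apply/negP => t2.
  have [j Mj] := random_fluctuation fpsP lamP varX Xc alphaR M.
  rewrite -!/(S _); set E : R := 8 ^+ j => gap.
  have E0 : 0 < E by rewrite exprn_gt0.
  (* Condition (i) at [n = i * 8 ^ j] and [k = n ^ 2], which is admissible because [t <= 2] gives
     [n^t <= n^2]. *)
  have dev (i : nat) : (0 < i)%N ->
      `|S (i ^ 2 * 64 ^ j)%N - (i ^ 2 * 64 ^ j)%:R * mean P X| < i%:R * E.
    move=> i0; pose n := (i * 8 ^ j)%N.
    have n0 : (0 < n)%N by rewrite muln_gt0 i0 expn_gt0.
    have nk : (i ^ 2 * 64 ^ j = n ^ 2)%N.
      by rewrite expnMn -[((8 ^ j) ^ 2)%N]expnM [(j * 2)%N]mulnC expnM.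
    have nE : n%:R = i%:R * E :> R by rewrite natrM natrX.
    rewrite nk; have := MP n (n ^ 2)%N; rewrite devE ?expn_gt0 ?n0 //.
    rewrite natrX expr2 -nE ltr_pM2r ?ltr0n // => -> //.
      apply: (leq_trans Mj); apply: (leq_trans (ltnW (ltn_expl j (isT : 1 < 8)%N))).
      exact: leq_pmull.
    rewrite -expr2 -powR_mulrn ?ler0n //; apply: ler_powR => //.
    by rewrite ler1n.
  (* In [2 S(25 F) - S(F) - S(49 F)] the means cancel since [2 * 25 = 1 + 49], and the errors add up
     to less than [(2 * 5 + 1 + 7) * E = 18 * E]. *)
  have := dev 1%N isT; have := dev 5%N isT; have := dev 7%N isT.
  rewrite exp1n mul1n (_ : 5 ^ 2 = 25)%N // (_ : 7 ^ 2 = 49)%N //.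
  rewrite !natrM; set F : R := (64 ^ j)%:R; set m := mean P X.
  rewrite !ltr_norml => /andP[a1 a2] /andP[b1 b2] /andP[c1 c2].
  by move: gap; rewrite ltNge => /negP; apply; rewrite ler_norml; lra.
have /choice[J JP] : forall a, exists j0 : nat, forall k,
    let j := trunc_log 4 k in (j0 <= j)%N ->
    `|(count_mem a (mkseq alpha k))%:R - k%:R * P a| <= 2 ^+ j * (j%:R ^+ 2 + 8).
  by move=> a; exact: (random_frequency fpsP lamP (Pc a) alphaR).
have [j1 j1P] := powR_dominates (\sum_a `|X a|) t2.
pose J' := maxn j1 (\max_a J a).
(* Since [n <= n^t <= k], the condition [4 ^ J' <= n] pushes the logarithm of [k] beyond all
   thresholds. *)
exists (4 ^ J')%N; first by rewrite expn_gt0.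
move=> n k Mn k0 ntk.
have n0 : (0 < n)%N by rewrite (leq_trans _ Mn) // expn_gt0.
rewrite -/(S k) devE //.
have nk : (n <= k)%N.
  rewrite -(ler_nat R); apply: le_trans ntk; rewrite -[leLHS]powRr1 ?ler0n //.
  by apply: ler_powR; rewrite ?ler1n //; lra.
pose j := trunc_log 4 k.
have Jj : (J' <= j)%N by apply: trunc_log_max => //; exact: leq_trans nk.
apply: le_lt_trans (j1P j n k _ n0 _ ntk); last 2 first.
- by apply: leq_trans Jj; rewrite leq_maxl.
- exact: trunc_logP.
rewrite ler_wpM2r // mulr_suml.
(* The deviation of the sum is a combination of the letter-count deviations with coefficients [X a],
   which explains the constant given to [powR_dominates]. *)
have -> : S k - k%:R * mean P X =
    \sum_a X a * ((count_mem a (mkseq alpha k))%:R - k%:R * P a).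
  have -> : S k = \sum_(b <- mkseq alpha k) X b.
    rewrite /S /mkseq big_map -(big_mkord predT (fun i => X (alpha i))).
    by rewrite /index_iota subn0.
  rewrite sum_count /mean mulr_sumr -sumrB; apply: eq_bigr => a _.
  by rewrite mulrBr mulrCA.
apply: le_trans (ler_norm_sum _ _ _) _; apply: ler_sum => a _.
rewrite normrM ler_wpM2l //; apply: JP.
apply: leq_trans Jj; rewrite leq_max; apply/orP; right.
exact: leq_bigmax.
Qed.
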